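(* Let $M$ be an oriented matroid on a finite set $E$ and let $\overline{M}$ be a generic extension-lifting of $M$ with respect to $(f,g)$. The mapping $-_AM\mapsto -_{fg}-_A\overline{M}$ (where $A\subseteq E$, and $-_{fg}$ denotes reorientation of the two elements $f$ and $g$) yields a bijection between the reorientations of $M$ compatible with the extension-lifting $\overline{M}$ and the bounded regions of $\overline{M}$ with respect to $(f,g)$.
   Context: Reorientations. For an oriented matroid $N$ and a subset $A$ of its ground set, $-_AN$ denotes the oriented matroid obtained from $N$ by reorienting the elements of $A$ (changing their signs in all signed circuits and cocircuits). An oriented matroid on $E$ is considered to have $2^{E}$ reorientations, one for each subset $A\subseteq E$, even if some of the resulting oriented matroids are equal. Acyclic means having no positive circuit; totally cyclic means having no positive cocircuit. The symbol $\setminus$ followed by an element denotes deletion and $/$ denotes contraction. Extensions and liftings. An extension of an oriented matroid $N$ on $S$ with respect to $f\notin S$ is an oriented matroid $\overline{N}$ on $S\cup\{f\}$ with $\overline{N}\setminus f=N$; it is generic if every circuit of $\overline{N}$ containing $f$ is spanning, that is, the (supports of) circuits of $\overline{N}$ containing $f$ are the sets $B\cup\{f\}$ where $B$ is a basis of $N$. A lifting of $N$ with respect to $g\notin S$ is an oriented matroid $\overline{N}$ on $S\cup\{g\}$ with $\overline{N}/g=N$; it is generic if the (supports of) cocircuits of $\overline{N}$ containing $g$ are the sets $(S\setminus B)\cup\{g\}$ where $B$ is a basis of $N$. Generic extension-lifting. Let $M$ be an oriented matroid on $E$ and let $f\neq g$ be elements not in $E$. A generic extension-lifting of $M$ with respect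 to $(f,g)$ is an oriented matroid $\overline{M}$ on $E\cup\{f,g\}$ such that $\overline{M}/g\setminus f=M$, and which is both a generic extension of $\overline{M}\setminus f$ with respect to $f$ and a generic lifting of $\overline{M}/g$ with respect to $g$. Here $\overline{M}/g$ is a generic extension of $M$ with respect to $f$, $\overline{M}\setminus f$ is a generic lifting of $M$ with respect to $g$, and $f$ and $g$ are neither loops nor coloops of $\overline{M}$. Compatibility. In a generic extension $N'$ of $M$ with respect to $f$, cocircuits $D$ of $M$ bijectively correspond to cocircuits $D\cup f$ of $N'$ containing $f$ (restricting to $D$ on $E$). A reorientation $-_AM$, $A\subseteq E$, is compatible with the extension $N'$ with respect to $f$ if, for every positive cocircuit $D$ of $-_AM$, the corresponding cocircuit $D\cup f$ of $-_AN'$ has a positive sign for $f$; equivalently, $-_f-_AN'$ is totally cyclic. In a generic lifting $N''$ of $M$ with respect to $g$, circuits $C$ of $M$ bijectively correspond to circuits $C\cup g$ of $N''$ containing $g$ (restricting to $C$ on $E$). A reorientation $-_AM$ is compatible with the lifting $N''$ with respect to $g$ if, for every positive circuit $C$ of $-_AM$, the corresponding circuit $C\cup g$ of $-_AN''$ has a positive sign for $g$; equivalently, $-_g-_AN''$ is acyclic. The reorientation $-_AM$ is compatible with the extension-lifting $\overline{M}$ if it is compatible both with the extension $\overline{M}/g$ of $M$ with respect to $f$ and with the lifting $\overline{M}\setminus f$ of $M$ with respect to $g$. Bounded regions. Let $\overline{M}$ be an oriented matroid on $E\cup\{f,g\}$, where $f,g\notin E$, $f\neq g$, and $f$ and $g$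 are neither loops nor coloops. A reorientation $-_A\overline{M}$ such that $f,g\notin A$, $(-_A\overline{M})\setminus f$ is acyclic and $(-_A\overline{M})/g$ is totally cyclic is called a bounded region of $\overline{M}$ with respect to $(f,g)$. *)

(* Defs.v *)
From mathcomp Require Import all_boot.

Set Implicit Arguments.
Unset Strict Implicit.
Unset Printing Implicit Defensive.

Section OrientedMatroids.

Variable T : finType.
Implicit Types (A B D S : {set T}) (e f g : T).

(* Signed subsets of T: [Some true] is the sign +, [Some false] the sign -,
   and [None] means that the element is not in the support. *)
Definition signed_set := {ffun T -> option bool}.
Implicit Types X Y Z : signed_set.

Definition pos X : {set T} := [set e | X e == Some true].
Definition neg X : {set T} := [set e | X e == Some false].
Definition supp X : {set T} := [set e | X e != None].
Definition positive X : bool := neg X == set0.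

Definition opp X : signed_set := [ffun e => omap negb (X e)].

Definition resign A X : signed_set :=
  [ffun e => if e \in A then omap negb (X e) else X e].

Definition restrict S X : signed_set :=
  [ffun e => if e \in S then X e else None].

Definition orthogonal X Y : bool :=
  [exists e in supp X :&: supp Y, X e == Y e] ==
  [exists e in supp X :&: supp Y, X e != Y e].

(* A ground set inside T together with a family of signed subsets, meant to be
   the signed circuits; the axioms are in [is_oriented_matroid] below.  Minors
   and reorientations are defined on this raw data, so that equality of
   oriented matroids is equality of ground sets and of signed circuits. *)
Definition circuit_system := ({set T} * {set signed_set})%type.
Implicit Types M N : circuit_system.

Definition ground N : {set T} := N.1.
Definition circuits N : {set signed_set} := N.2.

Definition is_oriented_matroid N : Prop :=
  [/\ forall X, X \in circuits N -> supp X != set0 /\ supp X \subset ground N,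
      forall X, X \in circuits N -> opp X \in circuits N,
      forall X Y, X \in circuits N -> Y \in circuits N ->
        supp X \subset supp Y -> X = Y \/ X = opp Y
    & forall X Y e, X \in circuits N -> Y \in circuits N ->
        X <> opp Y -> e \in pos X -> e \in neg Y ->
        exists Z, [/\ Z \in circuits N,
                      pos Z \subset (pos X :|: pos Y) :\ e
                    & neg Z \subset (neg X :|: neg Y) :\ e]].

Definition oriented_matroid_on S N : Prop :=
  is_oriented_matroid N /\ ground N = S.

Definition independent N S : bool :=
  (S \subset ground N) && [forall X in circuits N, ~~ (supp X \subset S)].

Definition bases N : {set {set T}} := [set B | maxset (independent N) B].

(* The signed cocircuits are the orthogonal signature of the cocircuits of the
   underlying matroid, the latter being the inclusion-minimal sets that meet
   every basis. *)
Definition meets_bases N D : bool :=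
  (D \subset ground N) && [forall B in bases N, B :&: D != set0].

Definition cocircuits N : {set signed_set} :=
  [set Y | minset (meets_bases N) (supp Y) &
           [forall X in circuits N, orthogonal X Y]].

Definition circuit_supports N : {set {set T}} := supp @: circuits N.
Definition cocircuit_supports N : {set {set T}} := supp @: cocircuits N.

Definition is_loop N e : bool := [set e] \in circuit_supports N.
Definition is_coloop N e : bool := [set e] \in cocircuit_supports N.

Definition delete e N : circuit_system :=
  (ground N :\ e, [set X in circuits N | e \notin supp X]).

Definition contract e N : circuit_system :=
  let traces := restrict (ground N :\ e) @: circuits N in
  (ground N :\ e,
   [set X in traces |
      minset [pred S | S \in (supp @: traces) :\ set0] (supp X)]).

Definition reorient A N : circuit_system :=
  (ground N, resign A @: circuits N).

Definition acyclic N : bool := [forall X in circuits N, ~~ positive X].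
Definition totally_cyclic N : bool := [forall Y in cocircuits N, ~~ positive Y].

Definition generic_extension N f N' : Prop :=
  [/\ f \notin ground N,
      oriented_matroid_on (f |: ground N) N',
      delete f N' = N
    & [set S in circuit_supports N' | f \in S] = [set f |: B | B in bases N]].

Definition generic_lifting N g N' : Prop :=
  [/\ g \notin ground N,
      oriented_matroid_on (g |: ground N) N',
      contract g N' = N
    & [set S in cocircuit_supports N' | g \in S] =
      [set g |: (ground N :\: B) | B in bases N]].

Definition generic_extension_lifting M f g Mbar : Prop :=
  [/\ oriented_matroid_on (f |: (g |: ground M)) Mbar,
      delete f (contract g Mbar) = M,
      generic_extension (delete f Mbar) f Mbar
    & generic_lifting (contract g Mbar) g Mbar].

(* Here D' is the cocircuit of the reoriented extension that contains f and
   restricts to D; it exists and is unique when the extension is generic.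
   Dually in [compatible_lifting]. *)
Definition compatible_extension M f N' A : bool :=
  [forall D in cocircuits (reorient A M),
    positive D ==>
    [forall D' in cocircuits (reorient A N'),
      (f \in supp D') && (restrict (ground M) D' == D) ==> (f \in pos D')]].

Definition compatible_lifting M g N' A : bool :=
  [forall C in circuits (reorient A M),
    positive C ==>
    [forall C' in circuits (reorient A N'),
      (g \in supp C') && (restrict (ground M) C' == C) ==> (g \in pos C')]].

(* A reorientation of N is represented by the subset A of the ground set, so
   that N has one reorientation per subset, even if some of the systems
   [reorient A N] coincide. *)
Definition compatible_reorientations M f g Mbar : {set {set T}} :=
  [set A : {set T} | [&& A \subset ground M,
                         compatible_extension M f (contract g Mbar) A
                       & compatible_lifting M g (delete f Mbar) A]].

(* Since circuits are closed under [opp], [reorient B N] and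
   [reorient (ground N :\: B) N] are the same system; f \notin B and g \notin B
   therefore do not exclude an oriented matroid obtained by reorienting a set
   that contains both f and g. *)
Definition bounded_regions f g N : {set {set T}} :=
  [set B : {set T} |
    [&& ~~ is_loop N f, ~~ is_coloop N f, ~~ is_loop N g & ~~ is_coloop N g] &&
    [&& B \subset ground N, f \notin B, g \notin B,
        acyclic (delete f (reorient B N))
      & totally_cyclic (contract g (reorient B N))]].

End OrientedMatroids.

(* Main.v *)
Require Import Defs.
From mathcomp Require Import all_boot.

(** The bijection sends A to E minus A: reorienting [A] together with [f] and
    [g] is reorienting the complement of that set, because circuits are closed
    under negation ([reorient_complement]).  So three things are to be proved:
    compatibility of A with the lifting says that this reorientation makes no
    circuit avoiding [f] positive ([compatible_lifting_acyclic]); compatibility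
    with the extension says that it makes no cocircuit of Mbar / g positive
    ([compatible_extension_totally_cyclic]); and different subsets of E give
    different reorientations ([reorient_extlift_inj]).

    For the lifting, a circuit through [g] has as its trace a circuit of M,
    and compatibility prescribes its sign at [g].  The case to exclude is a
    positive circuit D that avoids [g].  Colour [g] and the elements of D and
    apply the painting property: either some circuit inside D and [g] is
    positive on D with the forbidden sign at [g], or some cocircuit Y through
    [g] is nonnegative on D.  In the second case orthogonality makes Y
    disjoint from D; but genericity says that, outside [g], Y is the complement
    of a basis of Mbar / g, so D would lie in such a basis, although D is dependent in
    that contraction ([lifting_circuit]).  The argument for the extension is
    dual ([extension_cocircuit]): a circuit through [f] disjoint from a
    positive cocircuit D would give a basis of Mbar missed by D.

    The painting property is the alternative between circuits and cocircuits
    of an oriented matroid ([painting]).  With one signed class of elements it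
    follows by induction from its sign-free case ([circuit_or_cocircuit]),
    where the point is that cocircuits can be signed at all.  That is obtained
    by contracting elements one at a time down to rank one, where all circuits
    are pairs and the signs can be read off.  Contraction preserves the
    circuit axioms, and orthogonality can be lifted back from a contraction,
    because every circuit is a conformal union of circuits of the contraction
    ([contract_conformal]). *)

Set Implicit Arguments.
Unset Strict Implicit.
Unset Printing Implicit Defensive.

(** * Signed sets and orthogonality *)

Section SignedSets.
Variable T : finType.
Implicit Types (A B S : {set T}) (X Y Z : signed_set T).

Lemma in_supp X x : (x \in supp X) = (X x != None).
Proof. by rewrite inE. Qed.

Lemma oppE X x : opp X x = omap negb (X x).
Proof. by rewrite ffunE. Qed.

Lemma oppK : involutive (@opp T).
Proof. by move=> X; apply/ffunP=> x; rewrite !oppE; case: (X x) => [[]|]. Qed.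

Lemma supp_opp X : supp (opp X) = supp X.
Proof. by apply/setP=> x; rewrite !in_supp oppE; case: (X x). Qed.

Lemma supp_resign A X : supp (resign A X) = supp X.
Proof. by apply/setP=> x; rewrite !in_supp ffunE; case: ifP => _ //; case: (X x). Qed.

Lemma resignK A : involutive (@resign T A).
Proof.
by move=> X; apply/ffunP=> x; rewrite !ffunE; case: (x \in A); case: (X x) => [[]|].
Qed.

Lemma positive_resignP A X :
  reflect (forall x, X x <> Some (x \in A)) (positive (resign A X)).
Proof.
apply: (iffP eqP) => [/setP h x Xx | h].
  by have := h x; rewrite !inE ffunE Xx; case: (x \in A).
apply/setP=> x; rewrite !inE ffunE; apply/negP=> /eqP Xx; apply: (h x).
by move: Xx; case: (x \in A); case: (X x) => [[]|].
Qed.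

Lemma orthogonal_opposite X Y x : orthogonal X Y -> X x <> None -> X x = Y x ->
  exists y, [/\ X y <> None, Y y <> None & X y <> Y y].
Proof.
move=> /eqP oXY /eqP Xx XYx.
have : [exists e in supp X :&: supp Y, X e == Y e].
  by apply/existsP; exists x; rewrite in_setI !in_supp -XYx Xx eqxx.
rewrite oXY => /existsP[y /andP[]]; rewrite in_setI !in_supp.
by move=> /andP[/eqP ? /eqP ?] /eqP ?; exists y.
Qed.

Lemma orthogonal_oppl X Y : orthogonal (opp X) Y = orthogonal X Y.
Proof.
have e1 : [exists e in supp (opp X) :&: supp Y, opp X e == Y e] =
          [exists e in supp X :&: supp Y, X e != Y e].
  apply: eq_existsb => x; rewrite supp_opp in_setI !in_supp oppE.
  by case: (X x) => [[]|]; case: (Y x) => [[]|].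
have e2 : [exists e in supp (opp X) :&: supp Y, opp X e != Y e] =
          [exists e in supp X :&: supp Y, X e == Y e].
  apply: eq_existsb => x; rewrite supp_opp in_setI !in_supp oppE.
  by case: (X x) => [[]|]; case: (Y x) => [[]|].
by rewrite /orthogonal e1 e2 eq_sym.
Qed.

Lemma orthogonal_oppr X Y : orthogonal X (opp Y) = orthogonal X Y.
Proof.
have sym U V : orthogonal U V = orthogonal V U.
  rewrite /orthogonal setIC.
  have -> : [exists e in supp V :&: supp U, U e == V e] =
            [exists e in supp V :&: supp U, V e == U e].
    by apply: eq_existsb => x; rewrite eq_sym.
  congr (_ == _); by apply: eq_existsb => x; rewrite eq_sym.
by rewrite sym orthogonal_oppl sym.
Qed.

Lemma orthogonal_resign A X Y :
  orthogonal (resign A X) (resign A Y) = orthogonal X Y.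
Proof.
rewrite /orthogonal !supp_resign.
congr (_ == _); apply: eq_existsb => x; rewrite !ffunE;
  by case: ifP => //; case: (X x) => [[]|]; case: (Y x) => [[]|].
Qed.

Lemma orthogonalI X Y :
  (forall x, X x <> None -> Y x <> None ->
     (exists y, Y y <> None /\ X y = Y y) /\
     (exists y, [/\ X y <> None, Y y <> None & X y <> Y y])) ->
  orthogonal X Y.
Proof.
move=> h; apply/eqP.
have h' x : x \in supp X :&: supp Y ->
   (exists y, Y y <> None /\ X y = Y y) /\
     (exists y, [/\ X y <> None, Y y <> None & X y <> Y y]).
  by rewrite in_setI !in_supp => /andP[/eqP Xx /eqP Yx]; exact: (h x Xx Yx).
apply/existsP/existsP => -[x /andP[/h' [[y [Yy XYy]] [z [Xz Yz XYz]]] _]].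
  by exists z; rewrite in_setI !in_supp; apply/andP; split; [apply/andP; split|]; apply/eqP.
exists y; rewrite in_setI !in_supp XYy eqxx andbT andbb; exact/eqP.
Qed.

Lemma orthogonalE X Y x : orthogonal X Y -> X x <> None -> Y x <> None ->
  (exists y, Y y <> None /\ X y = Y y) /\
  (exists y, [/\ X y <> None, Y y <> None & X y <> Y y]).
Proof.
move=> oXY Xx Yx; case: (eqVneq (X x) (Y x)) => [XYx|/eqP XYx].
  by split; [exists x | apply: orthogonal_opposite oXY Xx XYx].
split; last by exists x.
have ox : orthogonal (opp X) Y by rewrite orthogonal_oppl.
have [||y []] := @orthogonal_opposite _ _ x ox; rewrite ?oppE.
- by case: (X x) Xx.
- by move: Xx Yx XYx; case: (X x) => [[]|] //; case: (Y x) => [[]|].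
move=> Xy Yy XYy; exists y; split=> //.
by move: Xy Yy XYy; case: (X y) => [[]|] //; case: (Y y) => [[]|].
Qed.

Lemma resign_resign A B X : [disjoint A & B] ->
  resign A (resign B X) = resign (A :|: B) X.
Proof.
move=> dAB; apply/ffunP=> x; rewrite !ffunE in_setU.
by case xA: (x \in A) => //=; rewrite (disjointFr dAB xA).
Qed.

Lemma restrict_resign S A X : restrict S (resign A X) = resign A (restrict S X).
Proof. by apply/ffunP=> x; rewrite !ffunE; case: (x \in S); case: (x \in A). Qed.

Lemma restrict_avoid S X x : x \notin supp X -> restrict (S :\ x) X = restrict S X.
Proof.
rewrite in_supp negbK => /eqP Xx; apply/ffunP=> y; rewrite !ffunE in_setD1.
by case: eqP => //= ->; rewrite Xx if_same.
Qed.

Lemma positiveP X : positive X -> forall x, X x <> Some false.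
Proof. by move=> /eqP/setP nX x Xx; have := nX x; rewrite !inE Xx eqxx. Qed.

(** If both sets respect the sign pattern [sg] wherever they meet, their signs
    agree on the whole intersection, and orthogonality then leaves no room for
    a common element. *)
Lemma conformal_disjoint (sg : T -> bool) X Y : orthogonal X Y ->
  (forall x, x \in supp Y -> X x <> Some (~~ sg x)) ->
  (forall x, x \in supp X -> Y x <> Some (~~ sg x)) ->
  [disjoint supp X & supp Y].
Proof.
move=> oXY sX sY; rewrite disjoint_subset; apply/subsetP=> x xX.
rewrite inE; apply/negP=> xY; move: (xX) (xY); rewrite !in_supp => /eqP Xx /eqP Yx.
have [_ [z [Xz Yz]]] := orthogonalE oXY Xx Yx; have := sX z; have := sY z.
rewrite !in_supp; move: Xz Yz.
by case: (X z) => [[]|]; case: (Y z) => [[]|]; case: (sg z) => // _ _ h h';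
  [case: (h isT) | case: (h' isT) | case: (h' isT) | case: (h isT)].
Qed.

Lemma disjoint_setU1 (x : T) A B :
  [disjoint x |: A & B] = (x \notin B) && [disjoint A & B].
Proof. by rewrite !disjoints_subset subUset sub1set inE. Qed.

End SignedSets.

(** * Circuits and contraction *)

Section Matroids.
Variable T : finType.
Implicit Types (A B K S R : {set T}) (D X Y Z W : signed_set T) (N : circuit_system T).

Lemma circuit_sub N X : is_oriented_matroid N -> X \in circuits N ->
  supp X \subset ground N.
Proof. by case=> h _ _ _ /h[]. Qed.

Lemma circuit_opp N X : is_oriented_matroid N -> X \in circuits N ->
  opp X \in circuits N.
Proof. by case=> _ h _ _; apply: h. Qed.

Lemma circuit_supp_eq N X Y : is_oriented_matroid N ->
  X \in circuits N -> Y \in circuits N -> supp X \subset supp Y ->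
  supp X = supp Y.
Proof.
case=> _ _ h _ CX CY XY; case: (h X Y CX CY XY) => -> //; exact: supp_opp.
Qed.

(** The elimination axiom is stated for a positive sign in the first circuit;
    since the other sign is obtained by exchanging the circuits, it can be used
    with an arbitrary sign [b]. *)
Lemma circuit_elim N X Y e b : is_oriented_matroid N ->
  X \in circuits N -> Y \in circuits N -> X <> opp Y ->
  X e = Some b -> Y e = Some (~~ b) ->
  exists Z, [/\ Z \in circuits N, Z e = None &
    forall x c, Z x = Some c -> X x = Some c \/ Y x = Some c].
Proof.
case=> _ _ _ ax.
have main U V : U \in circuits N -> V \in circuits N -> U <> opp V ->
    U e = Some true -> V e = Some false ->
    exists Z, [/\ Z \in circuits N, Z e = None &
      forall x c, Z x = Some c -> U x = Some c \/ V x = Some c].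
  move=> CU CV nUV Ue Ve.
  have [||Z [CZ /subsetP pZ /subsetP nZ]] := ax U V e CU CV nUV.
  - by rewrite inE Ue.
  - by rewrite inE Ve.
  exists Z; split=> //.
    case Ze: (Z e) => [[]|] //.
      by have /= := pZ e; rewrite !inE Ze !eqxx => /(_ isT).
    by have /= := nZ e; rewrite !inE Ze !eqxx => /(_ isT).
  move=> x [] Zx.
    have := pZ x; rewrite !inE Zx eqxx => /(_ isT) /andP[_ /orP[]] /eqP; by [left|right].
  have := nZ x; rewrite !inE Zx eqxx => /(_ isT) /andP[_ /orP[]] /eqP; by [left|right].
move=> CX CY nXY; case: b => Xe Ye; first exact: main.
have nYX : Y <> opp X by move=> YX; apply: nXY; rewrite YX oppK.
have [Z [CZ Ze h]] := main Y X CY CX nYX Ye Xe.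
exists Z; split=> // x c /h[]; by [right|left].
Qed.

Lemma traceE N X q x : is_oriented_matroid N -> X \in circuits N ->
  restrict (ground N :\ q) X x = if x == q then None else X x.
Proof.
move=> om CX; rewrite ffunE !inE; case: eqP => //= _.
case: ifP => // nx; case Xx: (X x) => //.
by have /subsetP/(_ x) := circuit_sub om CX; rewrite in_supp Xx nx => /(_ isT).
Qed.

Lemma supp_trace N X q : is_oriented_matroid N -> X \in circuits N ->
  supp (restrict (ground N :\ q) X) = supp X :\ q.
Proof.
move=> om CX; apply/setP=> x; rewrite in_supp traceE // in_setD1 in_supp.
by case: (x == q); rewrite ?eqxx.
Qed.

Lemma ground_contract q N : ground (contract q N) = ground N :\ q.
Proof. by []. Qed.

Lemma contractP N q W : is_oriented_matroid N ->
  reflect (exists X, [/\ X \in circuits N, W = restrict (ground N :\ q) X,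
      supp X :\ q != set0 &
      forall Z, Z \in circuits N -> supp Z :\ q != set0 ->
         supp Z :\ q \subset supp X :\ q -> supp Z :\ q = supp X :\ q])
    (W \in circuits (contract q N)).
Proof.
move=> om; rewrite inE; apply: (iffP andP).
  move=> [/imsetP[X CX ->] /minsetP[]].
  rewrite supp_trace //= in_setD1 => /andP[ne _] mn; exists X; split=> // Z CZ neZ sub.
  apply: mn => //=; rewrite in_setD1 neZ /=.
  apply/imsetP; exists (restrict (ground N :\ q) Z); first exact: imset_f.
  by rewrite supp_trace.
move=> [X [CX -> ne mn]]; split; first exact: imset_f.
apply/minsetP; split.
  rewrite /= in_setD1 supp_trace // ne -(supp_trace q om CX).
  by rewrite imset_f // imset_f.
move=> S /=; rewrite in_setD1 => /andP[neS /imsetP[_ /imsetP[Z CZ ->] eS]].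
by move: neS; rewrite eS !supp_trace // => neS sub; apply: mn.
Qed.

Lemma contract_supp_lift N q X : is_oriented_matroid N -> X \in circuits N ->
  supp X :\ q != set0 ->
  exists Z, [/\ Z \in circuits N, supp Z :\ q \subset supp X :\ q,
     supp Z :\ q != set0 &
     restrict (ground N :\ q) Z \in circuits (contract q N)].
Proof.
move=> om CX ne.
have PX : [pred S | S \in (@supp T @: (restrict (ground N :\ q) @: circuits N)) :\ set0]
   (supp X :\ q).
  by rewrite /= in_setD1 ne -(supp_trace q om CX) imset_f // imset_f.
have [S mS sS] := minset_exists PX.
have := minsetp mS; rewrite /= in_setD1 => /andP[neS /imsetP[_ /imsetP[Z CZ ->] eS]].
exists Z; rewrite -(supp_trace q om CZ) -eS; split=> //.
by rewrite inE imset_f //= -eS.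
Qed.

(** Traces of circuits through [q] are automatically minimal, since a smaller
    trace would come from a circuit properly contained in [X]. *)
Lemma trace_contract N q X : is_oriented_matroid N -> X \in circuits N ->
  q \in supp X -> supp X :\ q != set0 ->
  restrict (ground N :\ q) X \in circuits (contract q N).
Proof.
move=> om CX qX ne; apply/contractP=> //; exists X; split=> // Z CZ _ sub.
congr (_ :\ q); apply: circuit_supp_eq om CZ CX _.
apply/subsetP=> x xZ; case: (eqVneq x q) => [-> //|xq].
by have /subsetP/(_ x) := sub; rewrite !in_setD1 xq xZ => /(_ isT).
Qed.

(** Eliminate the disagreements of [W] with [X] one by one.  The result still
    contains [q], since otherwise it would be a circuit properly contained in
    [X], and it keeps the sign of [W] there since [X] avoids [q]. *)
Lemma conformal_circuit_through N q X W : is_oriented_matroid N ->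
  X \in circuits N -> q \notin supp X ->
  W \in circuits N -> q \in supp W -> supp W \subset q |: supp X ->
  exists Z, [/\ Z \in circuits N, Z q = W q &
     forall x c, x != q -> Z x = Some c -> X x = Some c].
Proof.
move=> om CX qX.
have [n] := ubnP #|[set x in supp X | W x == omap negb (X x)]|.
elim: n W => // n IH W; rewrite ltnS => leW CW qW sW.
have [/eqP e0 | [u]] := set_0Vmem [set x in supp X | W x == omap negb (X x)].
  exists W; split=> // x c xq Wx.
  have xX : x \in supp X.
    have /subsetP/(_ x) := sW; rewrite in_supp Wx => /(_ isT).
    by rewrite in_setU1 (negPf xq).
  have /eqP/setP/(_ x) := e0; rewrite !inE Wx; move: xX; rewrite in_supp.
  by case: (X x) => [[]|]; case: c {Wx}.
rewrite inE => /andP[uX /eqP Wu].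
have [b Xu] : exists b, X u = Some b.
  by move: uX; rewrite in_supp; case: (X u) => // b; exists b.
have Xq : X q = None by move: qX; rewrite in_supp; case: (X q).
have nXW : X <> opp W.
  by move=> XW; move: qW; rewrite -supp_opp -XW (negPf qX).
have [Z [CZ Zu hZ]] := circuit_elim om CX CW nXW Xu (etrans Wu (congr1 _ Xu)).
have sZ : supp Z \subset q |: supp X.
  apply/subsetP=> x; rewrite in_supp; case Zx: (Z x) => [c|//] _.
  case: (hZ x c Zx) => hx; first by rewrite in_setU1 in_supp hx orbT.
  by apply: (subsetP sW); rewrite in_supp hx.
have qZ : q \in supp Z.
  apply/negPn/negP=> qZ.
  have ZX : supp Z \subset supp X.
    apply/subsetP=> x xZ; have := subsetP sZ x xZ; rewrite in_setU1.
    by case: eqP => // xq; rewrite -xq xZ in qZ.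
  have := circuit_supp_eq om CZ CX ZX => /setP/(_ u).
  by rewrite !in_supp Zu Xu.
have ZqW : Z q = W q.
  move: qZ; rewrite in_supp; case Zq: (Z q) => [c|//] _.
  by case: (hZ q c Zq); rewrite ?Xq // => ->.
rewrite -ZqW; apply: IH => //.
apply: leq_trans leW; apply: proper_card; apply/properP; split.
  apply/subsetP=> x; rewrite !inE => /andP[xX /eqP Zx]; rewrite xX.
  case Xx: (X x) xX Zx => [c|//] _ /= Zx.
  by case: (hZ x _ Zx) => [|->] //; rewrite Xx; case: c {Xx Zx}.
exists u; first by rewrite inE uX Wu eqxx.
by rewrite inE Zu Xu andbF.
Qed.

(** A circuit is a conformal union of circuits of the contraction: if [X]
    avoids [q] and is not itself one, there are two circuits through [q],
    with opposite signs at [q], that conform to [X] elsewhere; eliminating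
    [q] between them gives back [X], so together they cover it. *)
Lemma contract_conformal N q X x : is_oriented_matroid N ->
  X \in circuits N -> X x <> None -> x != q ->
  exists W, [/\ W \in circuits (contract q N), W x = X x &
     forall y c, W y = Some c -> X y = Some c].
Proof.
move=> om CX Xx xq.
have trE Z y c : Z \in circuits N -> restrict (ground N :\ q) Z y = Some c ->
    y != q /\ Z y = Some c.
  by move=> CZ; rewrite traceE //; case: eqP.
have ne : supp X :\ q != set0.
  by apply/set0Pn; exists x; rewrite in_setD1 xq in_supp; apply/eqP.
have trX : restrict (ground N :\ q) X \in circuits (contract q N) ->
    exists W, [/\ W \in circuits (contract q N), W x = X x &
     forall y c, W y = Some c -> X y = Some c].
  move=> tX; exists (restrict (ground N :\ q) X); split=> //.
    by rewrite traceE // (negPf xq).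
  by move=> y c /trE[].
case: (boolP (q \in supp X)) => [qX | qX]; first by apply: trX; apply: trace_contract.
have [Z [CZ sZ neZ tZ]] := contract_supp_lift om CX ne.
have XD : supp X :\ q = supp X.
  by apply/setP=> y; rewrite in_setD1; case: eqP => // ->; rewrite (negPf qX).
case: (boolP (supp X :\ q \subset supp Z :\ q)) => [sX | nsX].
  apply: trX; apply/contractP=> //; exists X; split=> // V CV neV sV.
  have eZX : supp Z :\ q = supp X :\ q by apply/eqP; rewrite eqEsubset sZ.
  move/contractP: tZ => /(_ om) [U [CU eU _ mU]].
  have e1 : supp U :\ q = supp Z :\ q by rewrite -(supp_trace q om CU) -eU supp_trace.
  by rewrite -eZX -e1; apply: mU => //; rewrite e1 eZX.
have qZ : q \in supp Z.
  apply/negPn/negP=> qZ; case/negP: nsX.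
  have ZD : supp Z :\ q = supp Z.
    by apply/setP=> y; rewrite in_setD1; case: eqP => // ->; rewrite (negPf qZ).
  rewrite ZD XD; rewrite ZD XD in sZ; by rewrite (circuit_supp_eq om CZ CX sZ).
have sZ' : supp Z \subset q |: supp X.
  apply/subsetP=> y yZ; have := subsetP sZ y; rewrite !in_setD1 in_setU1 yZ.
  by case: eqP => //= _ /(_ isT).
have [b Zq] : exists b, Z q = Some b.
  by move: qZ; rewrite in_supp; case: (Z q) => // b; exists b.
have [Z1 [C1 q1 h1]] := conformal_circuit_through om CX qX CZ qZ sZ'.
have [||Z2 [C2 q2 h2]] := conformal_circuit_through om CX qX (circuit_opp om CZ).
- by rewrite supp_opp.
- by rewrite supp_opp.
rewrite oppE Zq /= in q2; rewrite Zq in q1.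
have ne' V c : V \in circuits N -> V q = Some c -> supp V :\ q != set0.
  move=> CV qV; apply/negP=> /eqP V0; case/eqP: neZ.
  have VZ : supp V \subset supp Z.
    apply/subsetP=> y; case: (eqVneq y q) => [-> //|yq yV].
    by have /setP/(_ y) := V0; rewrite in_setD1 yq yV inE.
  by rewrite -(circuit_supp_eq om CV CZ VZ).
have [p] := set0Pn _ (ne' _ _ C1 q1).
rewrite in_setD1 in_supp => /andP[pq p1].
have n12 : Z1 <> opp Z2.
  move=> e12; case E2: (Z2 p) => [d|]; last by move: p1; rewrite e12 oppE E2.
  have E1 : Z1 p = Some (~~ d) by rewrite e12 oppE E2.
  by have := h1 p _ pq E1; rewrite (h2 p d pq E2); case: (d).
have [V [CV Vq hV]] := circuit_elim om C1 C2 n12 q1 q2.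
(* V lies inside X, so it has the support of X and x is in Z1 or in Z2. *)
have VX y c : V y = Some c -> X y = Some c.
  move=> Vy; have yq : y != q by apply/negP=> /eqP yq; rewrite yq Vq in Vy.
  by case: (hV y c Vy); [apply: h1|apply: h2].
have sV : supp V \subset supp X.
  apply/subsetP=> y; rewrite !in_supp; case Vy: (V y) => [c|//].
  by rewrite (VX y c Vy).
have xV : x \in supp V by rewrite (circuit_supp_eq om CV CX sV) in_supp; apply/eqP.
have fin U d : U \in circuits N -> U q = Some d ->
   (forall y c, y != q -> U y = Some c -> X y = Some c) -> U x = X x ->
   exists W, [/\ W \in circuits (contract q N), W x = X x &
     forall y c, W y = Some c -> X y = Some c].
  move=> CU qU hU Ux; exists (restrict (ground N :\ q) U); split.
  - by apply: trace_contract => //; [rewrite in_supp qU | apply: ne' qU].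
  - by rewrite traceE // (negPf xq).
  - by move=> y c /trE[//|yq]; apply: hU.
move: xV; rewrite in_supp; case Vx: (V x) => [c|//] _.
by case: (hV x c Vx) => Ux; [apply: fin C1 q1 h1 _|apply: fin C2 q2 h2 _];
  rewrite (VX x c Vx).
Qed.

(** The elimination axiom in the contraction: eliminate between lifts of the
    two circuits, then pass from the trace of the result to a circuit of the
    contraction conforming to it.  The trace must not be empty, which could
    only happen if [q] were a loop contained in one of the lifts. *)
Lemma contract_om N q : is_oriented_matroid N -> is_oriented_matroid (contract q N).
Proof.
move=> om; split.
- move=> W /contractP-/(_ om)[X [CX -> ne _]]; rewrite supp_trace //; split=> //.
  by rewrite ground_contract; apply: setSD; apply: circuit_sub om CX.
- move=> W /contractP-/(_ om)[X [CX -> ne mn]]; apply/contractP=> //.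
  exists (opp X); rewrite supp_opp; split=> //; first exact: circuit_opp.
  by apply/ffunP=> x; rewrite !ffunE; case: ifP.
- move=> W1 W2 /contractP-/(_ om)[X [CX -> neX mX]] /contractP-/(_ om)[Y [CY -> neY mY]].
  rewrite !supp_trace // => XY; have eXY := mY X CX neX XY.
  have [_ _ inc _] := om.
  have aux b U V : U \in circuits N -> V \in circuits N -> (q \in supp U) = b ->
     (b -> q \in supp V) -> supp U :\ q = supp V :\ q -> supp U \subset supp V.
    move=> CU CV qU bV /setP e; apply/subsetP=> x xU; case: (eqVneq x q) => [xq|xq].
      by rewrite xq bV // -qU -xq.
    by have := e x; rewrite !in_setD1 xq xU /= => <-.
  have [eXY'|eXY'] : X = Y \/ X = opp Y.
    case qX: (q \in supp X); last by apply: inc => //; apply: aux CX CY qX _ eXY.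
    case qY: (q \in supp Y); first by apply: inc => //; apply: aux CX CY qX _ eXY.
    case: (inc Y X CY CX) => [|->|->]; rewrite ?oppK; try by [left|right].
    by apply: aux CY CX qY _ (esym eXY).
  + by left; rewrite eXY'.
  + right; rewrite eXY'; apply/ffunP=> x; rewrite !ffunE; by case: ifP.
move=> W1 W2 e /contractP-/(_ om)[X [CX -> neX mX]] /contractP-/(_ om)[Y [CY -> neY mY]].
rewrite !inE !traceE //; case: (e == q) => // nXY /eqP Xe /eqP Ye.
have nXY' : X <> opp Y.
  move=> eXY; apply: nXY; rewrite eXY; apply/ffunP=> x; rewrite !ffunE; by case: ifP.
have [Z [CZ Ze hZ]] := circuit_elim om CX CY nXY' Xe Ye.
have [z /andP[zq /eqP Zz]] : exists z, (z != q) && (Z z != None).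
  apply/existsP; apply: contraT => /existsPn n; exfalso.
  have Zq V : V \in circuits N -> q \in supp V -> supp V :\ q != set0 -> False.
    move=> CV qV /eqP neV; apply: neV.
    have ZV : supp Z \subset supp V.
      apply/subsetP=> x; rewrite in_supp => Zx; have := n x; rewrite Zx andbT negbK.
      by move/eqP->.
    rewrite -(circuit_supp_eq om CZ CV ZV); apply/setP=> x; rewrite in_setD1 in_supp in_set0.
    exact: negPf (n x).
  have [/(_ Z CZ)[/set0Pn[x]]] := om; rewrite in_supp => Zx _ _ _ _.
  have xq : x = q by have := n x; rewrite Zx andbT negbK => /eqP.
  move: Zx; rewrite xq; case E: (Z q) => [c|//] _.
  by case: (hZ q c E) => h; [apply: (Zq X)|apply: (Zq Y)]; rewrite ?in_supp ?h.
have [W [CW _ hW]] := contract_conformal om CZ Zz zq.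
have Wq : W q = None.
  by move: CW => /contractP-/(_ om)[U [CU -> _ _]]; rewrite traceE // eqxx.
have We : W e = None.
  by case We: (W e) => [c|//]; have := hW _ _ We; rewrite Ze.
exists W; split=> //; apply/subsetP=> x; rewrite !inE !traceE // => /eqP Wx.
- have -> : x != e by apply/negP=> /eqP xe; rewrite xe We in Wx.
  case: (eqVneq x q) => [xq|_]; first by rewrite xq Wq in Wx.
  by case: (hZ _ _ (hW _ _ Wx)) => ->; rewrite eqxx ?orbT.
- have -> : x != e by apply/negP=> /eqP xe; rewrite xe We in Wx.
  case: (eqVneq x q) => [xq|_]; first by rewrite xq Wq in Wx.
  by case: (hZ _ _ (hW _ _ Wx)) => ->; rewrite eqxx ?orbT.
Qed.

(** * Bases and cocircuits *)

Lemma independentP N S :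
  reflect (S \subset ground N /\ forall X, X \in circuits N -> ~~ (supp X \subset S))
    (independent N S).
Proof.
apply: (iffP andP) => -[sS h]; split=> //; first by move=> X; apply: (forall_inP h).
exact/forall_inP.
Qed.

Lemma basis_indep N B : B \in bases N -> independent N B.
Proof. by rewrite inE => /maxsetp. Qed.

Lemma basis_max N B S : B \in bases N -> independent N S -> B \subset S -> S = B.
Proof. by rewrite inE => /maxsetP[_ h]; apply: h. Qed.

Lemma basisI N B : independent N B ->
  (forall S, independent N S -> B \subset S -> S = B) -> B \in bases N.
Proof. by move=> iB h; rewrite inE; apply/maxsetP. Qed.

Lemma extend_to_basis N S : independent N S -> exists2 B, B \in bases N & S \subset B.
Proof. by move=> /maxset_exists[B mB sB]; exists B => //; rewrite inE. Qed.

Lemma exists_basis N : is_oriented_matroid N -> exists B, B \in bases N.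
Proof.
move=> [ne _ _ _]; have [|B bB _] := @extend_to_basis N set0; last by exists B.
by apply/independentP; split=> [|X /ne[]]; rewrite ?sub0set // subset0.
Qed.

Lemma exists_basis_delete f N : is_oriented_matroid N ->
  exists B, B \in bases (delete f N).
Proof.
move=> [ne _ _ _]; have [|B bB _] := @extend_to_basis (delete f N) set0; last by exists B.
apply/independentP; rewrite sub0set; split=> // X; rewrite inE subset0 => /andP[CX _].
by have [] := ne X CX.
Qed.

Lemma fundamental_circuit N B x : B \in bases N -> x \in ground N -> x \notin B ->
  exists X, [/\ X \in circuits N, x \in supp X & supp X \subset x |: B].
Proof.
move=> bB xN xB; have /independentP[sB iB] := basis_indep bB.
have [/exists_inP[X CX sX]|/exists_inPn h] :=
    boolP [exists X in circuits N, supp X \subset x |: B].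
  exists X; split=> //; apply: contraT => xX; case/negP: (iB X CX).
  apply/subsetP=> y yX; have := subsetP sX y yX; rewrite in_setU1.
  by case/orP=> // /eqP yx; rewrite -yx yX in xX.
have : independent N (x |: B).
  by apply/independentP; split=> //; rewrite subUset sub1set xN.
by move=> /(basis_max bB)/(_ (subsetUr _ _)) e; rewrite -e setU11 in xB.
Qed.

Lemma is_loopP N e :
  reflect (exists2 X, X \in circuits N & supp X = [set e]) (is_loop N e).
Proof. by apply: (iffP imsetP) => -[X CX eX]; exists X. Qed.

(** When [q] is a loop, contracting it amounts to deleting it. *)
Lemma independent_contract N q S : is_oriented_matroid N -> q \in ground N ->
  independent (contract q N) S =
  (q \notin S) && independent N (if is_loop N q then S else q |: S).
Proof.
move=> om qN; apply/idP/idP.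
  move=> /independentP[]; rewrite ground_contract => sS iS.
  have qS : q \notin S by apply/negP=> /(subsetP sS); rewrite !inE eqxx.
  have sSN : S \subset ground N by apply: subset_trans sS (subsetDl _ _).
  rewrite qS /=; apply/independentP; split.
    by case: ifP => _ //; rewrite subUset sub1set qN.
  move=> X CX; apply/negP=> sX.
  have sXq : supp X :\ q \subset S.
    apply/subsetP=> x; rewrite in_setD1 => /andP[xq /(subsetP sX)].
    by case: ifP => _ //; rewrite in_setU1 (negPf xq).
  have [X0|neX] := eqVneq (supp X :\ q) set0.
    have eX : supp X = [set q].
      apply/eqP; have [/(_ X CX)[neX _] _ _ _] := om.
      move: X0 neX => /eqP; rewrite setD_eq0 subset1 => /orP[//|/eqP ->].
      by rewrite eqxx.
    move: sX; have -> : is_loop N q by apply/is_loopP; exists X.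
    by rewrite eX sub1set (negPf qS).
  have [Z [CZ sZ _ tZ]] := contract_supp_lift om CX neX.
  by case/negP: (iS _ tZ); rewrite supp_trace //; apply: subset_trans sXq.
move=> /andP[qS /independentP[sS iS]]; apply/independentP; split.
  rewrite ground_contract subsetD1 qS andbT.
  by move: sS; case: ifP => // _; rewrite subUset => /andP[].
move=> _ /contractP-/(_ om)[X [CX -> neX _]]; rewrite supp_trace //.
apply/negP=> sX; case/negP: (iS X CX); case: ifP => [/is_loopP[L CL eL]|_].
  have qX : q \notin supp X.
    apply/negP=> qX; case/eqP: neX.
    rewrite -(circuit_supp_eq om CL CX) ?eL ?sub1set //.
    by apply/setP=> x; rewrite !inE; case: (x == q).
  by apply: subset_trans sX; rewrite subsetD1 subxx.
by rewrite -subDset.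
Qed.

Lemma basis_contract N q B : is_oriented_matroid N -> q \in ground N ->
  B \in bases (contract q N) -> (if is_loop N q then B else q |: B) \in bases N.
Proof.
move=> om qN bB; have := basis_indep bB.
rewrite independent_contract // => /andP[qB iB]; apply: basisI => // S iS.
have key S' : q \notin S' -> independent N (if is_loop N q then S' else q |: S') ->
    B \subset S' -> S' = B.
  by move=> qS' iS' sB; apply: basis_max bB _ sB; rewrite independent_contract // qS'.
move: iB key; case: ifP => [lq|_] iB key sB.
  apply: key => //; apply/negP=> qS; have [L CL eL] := is_loopP _ _ lq.
  by have /independentP[_ /(_ L CL)] := iS; rewrite eL sub1set qS.
have qS : q \in S by apply: (subsetP sB); rewrite setU11.
rewrite -(setD1K qS); congr (_ |: _); apply: key; rewrite ?setD1K //.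
  by rewrite !inE eqxx.
by rewrite subsetD1 qB andbT; apply: subset_trans sB; apply: subsetUr.
Qed.

Lemma cocircuitP N Y :
  reflect [/\ supp Y \subset ground N,
      forall B, B \in bases N -> B :&: supp Y != set0,
      forall K, K \subset supp Y -> (forall B, B \in bases N -> B :&: K != set0) ->
        supp Y \subset K
    & forall X, X \in circuits N -> orthogonal X Y]
   (Y \in cocircuits N).
Proof.
rewrite inE; apply: (iffP andP) => [[/minsetP[/andP[sY /forall_inP mY] mn]] /forall_inP oY|].
  split=> // K sK mK; rewrite (mn K) // /meets_bases (subset_trans sK sY) /=.
  exact/forall_inP.
move=> [sY mY mn oY]; split; last exact/forall_inP.
apply/minsetP; split; first by rewrite /meets_bases sY; apply/forall_inP.
move=> K /andP[_ /forall_inP mK] sK; apply/eqP; rewrite eqEsubset sK; exact: mn.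
Qed.

Lemma cocircuit_opp N Y : Y \in cocircuits N -> opp Y \in cocircuits N.
Proof.
move=> /cocircuitP[sY mY mn oY]; apply/cocircuitP; rewrite supp_opp; split=> //.
by move=> X CX; rewrite orthogonal_oppr oY.
Qed.

(** If [B] missed [Y], an element [e] of [Y] would lie outside [B] and the
    fundamental circuit of [e] would meet [Y] in [e] alone, which contradicts
    orthogonality. *)
Lemma orthogonal_meets_bases N Y B : supp Y \subset ground N -> supp Y != set0 ->
  (forall X, X \in circuits N -> orthogonal X Y) -> B \in bases N ->
  B :&: supp Y != set0.
Proof.
move=> sY /set0Pn[e eY] oY bB; apply/negP=> /eqP/setP BY.
have eB : e \notin B by apply/negP=> eB; have := BY e; rewrite in_setI eB eY inE.
have [X [CX eX sX]] := fundamental_circuit bB (subsetP sY e eY) eB.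
have only y : X y <> None -> Y y <> None -> y = e.
  move=> /eqP Xy /eqP Yy; have := subsetP sX y; rewrite in_supp => /(_ Xy).
  rewrite in_setU1 => /orP[/eqP //|yB].
  by have := BY y; rewrite in_setI yB in_supp Yy inE.
have [||[y [Yy XYy]] [z [Xz Yz XYz]]] := @orthogonalE _ X Y e (oY X CX).
- by move: eX; rewrite in_supp => /eqP.
- by move: eY; rewrite in_supp => /eqP.
have ye : y = e by apply: only => //; rewrite XYy.
by move: XYz; rewrite (only z Xz Yz) -ye XYy.
Qed.

(** Orthogonality to a circuit [X] of [N] follows from a circuit of the
    contraction conforming to [X].  Minimality is inherited because a basis of
    the contraction is a basis of [N], up to the element [q], which is not in
    [Y]. *)
Lemma cocircuit_of_contract N q Y : is_oriented_matroid N -> q \in ground N ->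
  Y \in cocircuits (contract q N) -> Y \in cocircuits N.
Proof.
move=> om qN /cocircuitP[]; rewrite ground_contract subsetD1 => /andP[sY qY] mY mn oY.
have oY' X : X \in circuits N -> orthogonal X Y.
  move=> CX; apply: orthogonalI => x Xx Yx.
  have xq : x != q by apply: contra qY => /eqP <-; rewrite in_supp; apply/eqP.
  have [W [CW Wx hW]] := contract_conformal om CX Xx xq.
  have eW y : W y <> None -> W y = X y by case Wy: (W y) => [c|//] _; rewrite (hW y c).
  rewrite -Wx in Xx; have [[y [Yy XYy]] [z [Xz Yz XYz]]] := orthogonalE (oY W CW) Xx Yx.
  split; first by exists y; rewrite -eW // XYy.
  by exists z; rewrite -eW.
apply/cocircuitP; split=> //.
  move=> B; apply: orthogonal_meets_bases => //.
  have [B' bB'] := exists_basis (contract_om q om).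
  by have /set0Pn[x] := mY B' bB'; rewrite in_setI => /andP[_ xY]; apply/set0Pn; exists x.
move=> K sK mK; apply: mn => // B bB.
have /set0Pn[x] := mK _ (basis_contract om qN bB).
rewrite in_setI => /andP[xB xK]; apply/set0Pn; exists x; rewrite in_setI xK andbT.
move: xB; case: ifP => // _; rewrite in_setU1 => /orP[/eqP xq|//].
by rewrite -xq (subsetP sK) in qY.
Qed.

(** * Existence of cocircuits and painting *)

(** The base case of the signing of cocircuits: no loops, and all elements
    parallel.  The cocircuit is the whole ground set; the sign of [q] is chosen
    to make [Y] orthogonal to the pair of [e] and [q], and eliminating [e]
    between two such pairs shows that it is orthogonal to all other pairs. *)
Lemma cocircuit_rank1 N e : is_oriented_matroid N -> e \in ground N ->
  ~~ is_loop N e ->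
  (forall q, q \in ground N -> q != e ->
     exists2 X, X \in circuits N & supp X = [set e; q]) ->
  exists2 Y, Y \in cocircuits N & e \in supp Y.
Proof.
move=> om eN nle par.
(* The circuit with support e and q is normalized to be negative at e, so
   that its sign at q can serve as the sign of Y. *)
pose P q X := [&& X \in circuits N, supp X == [set e; q] & X e == Some false].
pose Y : signed_set T := [ffun q => if q == e then Some true else
   if [pick X | P q X] is Some X then X q else None].
have Ye : Y e = Some true by rewrite ffunE eqxx.
have par' q : q \in ground N -> q != e -> exists X,
    [/\ X \in circuits N, supp X = [set e; q], X e = Some false & X q = Y q].
  move=> qN qe; rewrite ffunE (negPf qe); case: pickP => [X /and3P[CX /eqP eX /eqP Xe]|n].
    by exists X.
  have [X CX eX] := par q qN qe.
  case Xe: (X e) => [[]|].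
  - have := n (opp X); rewrite /P (circuit_opp om CX) supp_opp eX eqxx oppE Xe.
    by rewrite eqxx.
  - by have := n X; rewrite /P CX eX Xe !eqxx.
  - by have /setP/(_ e) := eX; rewrite in_supp Xe !inE eqxx.
have sY : supp Y = ground N.
  apply/setP=> q; rewrite in_supp; have [->|qe] := eqVneq q e; first by rewrite Ye eN.
  case: (boolP (q \in ground N)) => qN.
    have [X [_ eX _ <-]] := par' q qN qe.
    by have /setP/(_ q) := eX; rewrite in_supp !inE eqxx orbT => ->.
  rewrite ffunE (negPf qe); case: pickP => [X /and3P[CX /eqP eX _]|//].
  case/negP: qN; apply: (subsetP (circuit_sub om CX)).
  by rewrite eX !inE eqxx orbT.
have noloop u : ~~ is_loop N u.
  have [->//|ue] := eqVneq u e; apply/is_loopP=> -[L CL eL].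
  have uN : u \in ground N by apply: (subsetP (circuit_sub om CL)); rewrite eL set11.
  have [X CX eX] := par u uN ue.
  have : supp L = supp X.
    by apply: circuit_supp_eq om CL CX _; rewrite eL eX sub1set !inE eqxx orbT.
  by rewrite eL eX => /setP/(_ e); rewrite !inE eqxx eq_sym (negPf ue).
have pairs u v : u \in ground N -> v \in ground N -> u != v -> exists X,
    [/\ X \in circuits N, supp X = [set u; v], X u = Y u & X v = opp Y v].
  move=> uN vN uv; rewrite oppE.
  have [ue|ue] := eqVneq u e.
    have [|X [CX eX Xe Xv]] := par' v vN; first by rewrite -ue eq_sym.
    exists (opp X); rewrite supp_opp !oppE; split=> //; first exact: circuit_opp.
    - by rewrite ue.
    - by rewrite ue Xe Ye.
    - by rewrite Xv.
  have [ve|ve] := eqVneq v e.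
    have [X [CX eX Xe Xu]] := par' u uN ue.
    exists X; split=> //; first by rewrite ve setUC.
    by rewrite ve Xe Ye.
  have [U [CU eU Ue Uu]] := par' u uN ue.
  have [V [CV eV Ve Vv]] := par' v vN ve.
  have nUV : U <> opp (opp V).
    rewrite oppK => UV; move: eV; rewrite -UV eU => /setP/(_ u).
    by rewrite !inE eqxx (negPf ue) (negPf uv).
  have Ve' : opp V e = Some (~~ false) by rewrite oppE Ve.
  have [Z [CZ Ze hZ]] := circuit_elim om CU (circuit_opp om CV) nUV Ue Ve'.
  have vu : v != u by rewrite eq_sym.
  have Uv : U v = None.
    by have /setP/(_ v) := eU; rewrite in_supp !inE (negPf ve) (negPf vu); case: (U v).
  have Vu : V u = None.
    by have /setP/(_ u) := eV; rewrite in_supp !inE (negPf ue) (negPf uv); case: (V u).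
  have sZ : supp Z \subset [set u; v].
    apply/subsetP=> x; rewrite in_supp; case Zx: (Z x) => [c|//] _.
    have xe : x != e by apply/eqP=> xe; rewrite xe Ze in Zx.
    case: (hZ x c Zx) => h.
      have /setP/(_ x) := eU; rewrite in_supp h !inE (negPf xe) => /esym/= /eqP ->.
      by rewrite eqxx.
    have /setP/(_ x) := eV; rewrite -supp_opp in_supp h !inE (negPf xe) => /esym/= /eqP ->.
    by rewrite eqxx orbT.
  have full : supp Z = [set u; v].
    apply/eqP; rewrite eqEsubset sZ /=; apply/subsetP=> x; rewrite !inE.
    have alone a b : [set u; v] = [set a; b] -> Z a = None -> False.
      move=> uvab Za; have [/(_ Z CZ)[neZ _] _ _ _] := om.
      have : supp Z \subset [set b].
        apply/subsetP=> y yZ; have := subsetP sZ y yZ; rewrite uvab !inE.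
        by case/orP=> // /eqP ya; rewrite ya in_supp Za in yZ.
      rewrite subset1 => /orP[/eqP eZ|/eqP eZ]; last by rewrite eZ eqxx in neZ.
      by case/negP: (noloop b); apply/is_loopP; exists Z.
    case/orP=> /eqP ->; apply/eqP=> Za; first exact: (alone u v).
    by apply: (alone v u) => //; rewrite setUC.
  exists Z; split=> //.
    have : u \in supp Z by rewrite full !inE eqxx.
    rewrite in_supp; case Zu: (Z u) => [c|//] _.
    by case: (hZ u c Zu) => h; [rewrite -Uu h | move: h; rewrite oppE Vu].
  have : v \in supp Z by rewrite full !inE eqxx orbT.
  rewrite in_supp; case Zv: (Z v) => [c|//] _.
  by case: (hZ v c Zv) => h; [move: h; rewrite Uv | rewrite -Vv -oppE h].
have two X : X \in circuits N -> exists u v,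
    [/\ u \in supp X, v \in supp X & u != v].
  move=> CX; have [/(_ X CX)[/set0Pn[u uX] _] _ _ _] := om.
  have [/eqP Xu|/set0Pn[v]] := boolP (supp X :\ u == set0).
    case/negP: (noloop u); apply/is_loopP; exists X => //.
    by rewrite -(setD1K uX) Xu setU0.
  by rewrite in_setD1 => /andP[vu vX]; exists u, v; rewrite eq_sym.
have sN X u : X \in circuits N -> u \in supp X -> u \in ground N.
  by move=> CX; apply: (subsetP (circuit_sub om CX)).
have oY X : X \in circuits N -> orthogonal X Y.
  move=> CX; have [u [v [uX vX uv]]] := two X CX.
  have [||Z [CZ eZ Zu Zv]] := pairs u v _ _ uv; try exact: sN CX _.
  have oZ : orthogonal Z Y.
    have YN w : w \in supp X -> Y w <> None.
      by move=> /(sN _ _ CX); rewrite -sY in_supp => /eqP.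
    have Yv := YN v vX; have Yu := YN u uX.
    apply: orthogonalI => _ _ _; split; [exists u | exists v] => //.
    rewrite Zv oppE; split=> //; by case: (Y v) Yv => [[]|].
  have [_ _ inc _] := om; case: (inc Z X CZ CX) => [|<- //|eZX].
    by rewrite eZ subUset !sub1set uX vX.
  by rewrite -orthogonal_oppl -eZX.
have single x : x \in ground N -> [set x] \in bases N.
  move=> xN; apply: basisI => [|S /independentP[sS iS] xS].
    apply/independentP; split=> [|X CX]; first by rewrite sub1set.
    have [u [v [uX vX uv]]] := two X CX; apply/subsetPn.
    by have [ux|ux] := eqVneq u x; [exists v | exists u]; rewrite // inE // -ux eq_sym.
  apply/eqP; rewrite eqEsubset xS andbT; apply/subsetP=> y yS; rewrite inE.
  apply: contraT => yx; have [X [CX eX _ _]] := pairs y x (subsetP sS y yS) xN yx.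
  by case/negP: (iS X CX); rewrite eX subUset xS sub1set yS.
exists Y; last by rewrite sY.
apply/cocircuitP; rewrite sY; split=> //.
  move=> B bB; rewrite -sY; apply: (@orthogonal_meets_bases N) => //; rewrite sY //.
  by apply/set0Pn; exists e.
move=> K sK mK; apply/subsetP=> x xN; have /set0Pn[y] := mK _ (single x xN).
by rewrite !inE => /andP[/eqP ->].
Qed.

(** Contract any element whose contraction does not turn [e] into a loop.  When
    there is none left, every other element is parallel to [e]. *)
Lemma nonloop_cocircuit N e : is_oriented_matroid N -> e \in ground N ->
  ~~ is_loop N e -> exists2 Y, Y \in cocircuits N & e \in supp Y.
Proof.
have [n] := ubnP #|ground N|; elim: n N => // n IH N; rewrite ltnS => leN om eN nle.
have [/exists_inP[q]|/exists_inPn h] :=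
    boolP [exists q in ground N :\ e, ~~ is_loop (contract q N) e].
  rewrite in_setD1 => /andP[qe qN] nl.
  have [||||Y CY eY] := IH (contract q N) => //.
  - by apply: leq_trans leN; rewrite ground_contract [X in _ < X](cardsD1 q) qN.
  - exact: contract_om.
  - by rewrite ground_contract in_setD1 eN eq_sym qe.
  by exists Y => //; apply: cocircuit_of_contract CY.
apply: cocircuit_rank1 => // q qN qe.
have : is_loop (contract q N) e.
  by have := h q; rewrite in_setD1 qe qN negbK => /(_ isT).
case/is_loopP=> W /contractP-/(_ om)[X [CX -> _ _]]; rewrite supp_trace // => eX.
exists X => //; have [qX|qX] := boolP (q \in supp X).
  by rewrite -(setD1K qX) eX setUC.
case/negP: nle; apply/is_loopP; exists X => //; rewrite -eX.
by apply/setP=> x; rewrite in_setD1; case: eqP => // ->; rewrite (negPf qX).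
Qed.

(** Contracting [R] reduces this to whether [e] has become a loop. *)
Lemma circuit_or_cocircuit N e R : is_oriented_matroid N -> e \in ground N ->
  R \subset ground N -> e \notin R ->
  (exists X, [/\ X \in circuits N, e \in supp X & supp X \subset e |: R]) \/
  (exists Y, [/\ Y \in cocircuits N, e \in supp Y & [disjoint supp Y & R]]).
Proof.
have [n] := ubnP #|R|; elim: n N R => // n IH N R; rewrite ltnS => leR om eN sR eR.
have [R0|[r rR]] := set_0Vmem R.
  have [/is_loopP[X CX eX]|/(nonloop_cocircuit om eN)[Y CY eY]] := boolP (is_loop N e).
    by left; exists X; rewrite eX set11 sub1set setU11.
  by right; exists Y; rewrite R0 -setI_eq0 setI0.
have rN := subsetP sR r rR.
have [|||||[W [CW eW sW]]|[Y [CY eY dY]]] := IH (contract r N) (R :\ r).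
- by apply: leq_trans leR; rewrite [X in _ < X](cardsD1 r) rR.
- exact: contract_om.
- by rewrite ground_contract in_setD1 eN andbT; apply: contraNneq eR => ->.
- by rewrite ground_contract setSD.
- by rewrite in_setD1 (negPf eR) andbF.
- left; move: CW eW sW => /contractP-/(_ om)[X [CX -> _ _]]; rewrite supp_trace //.
  rewrite in_setD1 => /andP[_ eX] sX; exists X; split=> //.
  apply/subsetP=> x xX; have := subsetP sX x; rewrite !inE -in_supp xX andbT.
  by have [->|_ /(_ isT)] := eqVneq x r; [rewrite rR orbT|].
right; exists Y; split=> //; first exact: cocircuit_of_contract CY.
have /cocircuitP[sY _ _ _] := CY; rewrite -(setD1K rR) disjoint_sym.
rewrite disjoint_setU1 (disjoint_sym (mem (R :\ r))) dY andbT.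
by apply/negP=> /(subsetP sY); rewrite !inE eqxx.
Qed.

(** Here circuits are confined to [e], [S] and [R], cocircuits avoid [R], and
    the signs are constrained on [S] only.  For the induction, an element [s]
    of [S] is moved once to [R] and once out of both classes.  Unless this
    already yields what is required, it produces a circuit and a cocircuit
    both with the wrong sign at [s]; they agree at [s], at [e] and at
    every other common element, against orthogonality. *)
Lemma painting N (sg : T -> bool) e S R : is_oriented_matroid N ->
  e \in ground N -> S \subset ground N -> R \subset ground N ->
  e \notin S -> e \notin R -> [disjoint S & R] ->
  (exists X, [/\ X \in circuits N, X e = Some (sg e),
      forall s, s \in S -> X s <> Some (~~ sg s) & supp X \subset e |: (S :|: R)]) \/
  (exists Y, [/\ Y \in cocircuits N, Y e = Some (sg e),
      forall s, s \in S -> Y s <> Some (~~ sg s) & [disjoint supp Y & R]]).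
Proof.
move=> om eN; have [n] := ubnP #|S|; elim: n S R => // n IH S R.
rewrite ltnS => leS sS sR eS eR dSR.
have [S0|[s sS']] := set_0Vmem S.
  have sgn U : e \in supp U -> U e = Some (sg e) \/ opp U e = Some (sg e).
    by rewrite in_supp oppE; case: (U e) => [[]|] //; case: (sg e); auto.
  case: (circuit_or_cocircuit om eN sR eR) => -[U [CU eU hU]]; [left|right];
    case: (sgn U eU) => Ue.
  - by exists U; split=> //; rewrite S0 ?set0U // => x; rewrite inE.
  - exists (opp U); split; rewrite ?supp_opp ?S0 ?set0U //; first exact: circuit_opp.
    by move=> x; rewrite inE.
  - by exists U; split=> // x; rewrite S0 inE.
  - exists (opp U); split; rewrite ?supp_opp //; first exact: cocircuit_opp.
    by move=> x; rewrite S0 inE.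
have sN := subsetP sS s sS'.
have sRn : s \notin R by rewrite (disjointFr dSR).
have lt : #|S :\ s| < n by apply: leq_trans leS; rewrite [X in _ < X](cardsD1 s) sS'.
have sD : S :\ s \subset ground N by apply: subset_trans sS; apply: subsetDl.
have eD : e \notin S :\ s by rewrite in_setD1 (negPf eS) andbF.
have dD : [disjoint S :\ s & R] by apply: disjointWl dSR; apply: subsetDl.
have es : e != s by apply: contraNneq eS => ->.
have [||||[X [CX Xe hX sX]]|[Y [CY Ye hY dY]]] := IH (S :\ s) (s |: R) lt sD.
- by rewrite subUset sub1set sN.
- exact: eD.
- by rewrite in_setU1 negb_or es.
- by rewrite disjoint_sym disjoint_setU1 !inE eqxx /= disjoint_sym.
- have sX' : supp X \subset e |: (S :|: R).
    apply: subset_trans sX _; rewrite setUS //; apply/subsetP=> x; rewrite !inE.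
    by case: eqP => [->|_] /=; rewrite ?sS'.
  have [/eqP Xs|/eqP Xs] := boolP (X s == Some (~~ sg s)); last first.
    left; exists X; split=> // x xS; have [->//|xs] := eqVneq x s.
    by apply: hX; rewrite in_setD1 xs.
  case: (IH (S :\ s) R lt sD sR eD eR dD) => [[U [CU Ue hU sU]]|[Y [CY Ye hY dY]]].
    have Us : U s = None.
      case Us: (U s) => [c|//]; have := subsetP sU s; rewrite in_supp Us => /(_ isT).
      by rewrite !inE eqxx (negPf sRn) eq_sym (negPf es).
    left; exists U; split=> //.
      by move=> x xS; have [->|xs] := eqVneq x s; [rewrite Us|apply: hU; rewrite in_setD1 xs].
    by apply: subset_trans sU _; rewrite setUS // setSU // subsetDl.
  have [/eqP Ys|/eqP Ys] := boolP (Y s == Some (~~ sg s)); last first.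
    right; exists Y; split=> // x xS; have [->//|xs] := eqVneq x s.
    by apply: hY; rewrite in_setD1 xs.
  have /cocircuitP[_ _ _ oY] := CY.
  have [||z [Xz Yz []]] := @orthogonal_opposite _ X Y e (oY X CX).
  - by rewrite Xe.
  - by rewrite Xe Ye.
  have [->|ze] := eqVneq z e; first by rewrite Xe Ye.
  have [->|zs] := eqVneq z s; first by rewrite Xs Ys.
  have zS : z \in S :\ s.
    rewrite in_setD1 zs /=; have := subsetP sX' z; rewrite in_supp; case: (X z) Xz => // c _.
    move=> /(_ isT); rewrite !inE (negPf ze) /= => /orP[//|zR].
    by move: dY; rewrite disjoint_sym => /disjointFr/(_ zR); rewrite in_supp; case: (Y z) Yz.
  by move: Xz Yz (hX z zS) (hY z zS); case: (X z) => [[]|]; case: (Y z) => [[]|]; case: (sg z).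
right; exists Y; split=> //.
  move=> x xS; have [->|xs] := eqVneq x s; last by apply: hY; rewrite in_setD1 xs.
  move=> Ys; have := disjointFr dY (x := s); rewrite in_supp Ys setU11; by move/(_ isT).
by apply: disjointWr dY; apply: subsetUr.
Qed.

(** * Reorientation and deletion *)

Lemma mem_circuits_reorient A N X :
  (X \in circuits (reorient A N)) = (resign A X \in circuits N).
Proof. by rewrite -{1}[X](resignK A) mem_imset //; apply: can_inj (resignK A). Qed.

Lemma bases_reorient A N : bases (reorient A N) = bases N.
Proof.
apply/setP=> B; rewrite !inE; apply: maxset_eq => S; apply/independentP/independentP.
  move=> [sS h]; split=> // X CX; have := h (resign A X).
  by rewrite mem_circuits_reorient resignK supp_resign; apply.
move=> [sS h]; split=> // X; rewrite mem_circuits_reorient => /h.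
by rewrite supp_resign.
Qed.

Lemma mem_cocircuits_reorient A N Y :
  (Y \in cocircuits (reorient A N)) = (resign A Y \in cocircuits N).
Proof.
apply/cocircuitP/cocircuitP; rewrite bases_reorient !supp_resign => -[? ? ? oY]; split=> //.
  move=> X CX; rewrite -[X](resignK A) orthogonal_resign; apply: oY.
  by rewrite mem_circuits_reorient resignK.
by move=> X; rewrite mem_circuits_reorient => /oY; rewrite orthogonal_resign.
Qed.

Lemma reorient_reorient A B N : [disjoint A & B] ->
  reorient A (reorient B N) = reorient (A :|: B) N.
Proof.
move=> dAB; congr pair; rewrite -imset_comp; apply: eq_imset => X /=.
exact: resign_resign.
Qed.

Lemma reorientK A : involutive (@reorient T A).
Proof.
move=> [G C]; congr pair; rewrite /= -imset_comp -[RHS]imset_id.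
by apply: eq_imset => X /=; rewrite resignK.
Qed.

Lemma contract_reorient q A N : contract q (reorient A N) = reorient A (contract q N).
Proof.
have tr : restrict (ground N :\ q) @: (resign A @: circuits N) =
          resign A @: (restrict (ground N :\ q) @: circuits N).
  by rewrite -!imset_comp; apply: eq_imset => X /=; rewrite restrict_resign.
have st : (@supp T) @: (resign A @: (restrict (ground N :\ q) @: circuits N)) =
          (@supp T) @: (restrict (ground N :\ q) @: circuits N).
  by rewrite -imset_comp; apply: eq_imset => X /=; rewrite supp_resign.
congr pair; rewrite tr; apply/setP=> X.
rewrite -{2}[X](resignK A) mem_imset; last exact: can_inj (resignK A).
rewrite !inE st supp_resign -{1}[X](resignK A) mem_imset //; exact: can_inj (resignK A).
Qed.

(** Complementary reorientations of a circuit are opposite to each other. *)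
Lemma reorient_setC A N : is_oriented_matroid N -> A \subset ground N ->
  reorient (ground N :\: A) N = reorient A N.
Proof.
move=> om sA; congr pair; apply/setP=> X.
have op (D D' : {set T}) : D' = ground N :\: D ->
    resign D X \in circuits N -> resign D' X \in circuits N.
  move=> -> CX; have sX := circuit_sub om CX; rewrite supp_resign in sX.
  suff -> : resign (ground N :\: D) X = opp (resign D X) by apply: circuit_opp.
  apply/ffunP=> x; rewrite !ffunE in_setD.
  have := subsetP sX x; rewrite in_supp.
  case: (X x) => [c|_]; last by do 2 case: ifP.
  by move=> -> //; case: (x \in D) => //=; rewrite negbK.
rewrite -[LHS]/(X \in circuits (reorient _ N)) -[RHS]/(X \in circuits (reorient _ N)).
rewrite !mem_circuits_reorient; apply/idP/idP; apply: op => //.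
by rewrite setDDr setDv set0U; apply/esym/setIidPr.
Qed.

Lemma independent_delete f N S :
  independent (delete f N) S = (f \notin S) && independent N S.
Proof.
apply/independentP/andP; rewrite subsetD1.
  move=> [/andP[sS fS] h]; split=> //; apply/independentP; split=> // X CX.
  apply/negP=> sX; have := h X; rewrite inE CX sX => /(_ _)/negP; apply=> //.
  by apply: contra fS; apply: (subsetP sX).
move=> [fS /independentP[sS h]]; rewrite sS fS; split=> // X; rewrite inE => /andP[CX _].
exact: h.
Qed.

(** The circuit hypothesis says that [f] cannot be added to [B], so that [B]
    stays maximal when [f] is put back. *)
Lemma basis_of_delete f N B : B \in bases (delete f N) ->
  f |: B \in circuit_supports N -> B \in bases N.
Proof.
move=> bB /imsetP[X CX eX]; have := basis_indep bB.
rewrite independent_delete => /andP[fB iB]; apply: basisI => // S iS sB.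
apply: (basis_max bB _ sB); rewrite independent_delete iS andbT.
apply/negP=> fS; have /independentP[_ /(_ X CX)] := iS.
by rewrite -eX subUset sub1set fS sB.
Qed.

(** For a set [K] meeting all bases of the deletion, adding [f] gives a set
    that meets all bases of [N]; hence minimality passes to the deletion.  The
    hypothesis on bases, which says that [f] is not a coloop, gives that the
    restriction still meets every basis. *)
Lemma cocircuit_delete f N Y : (forall B, B \in bases (delete f N) -> B \in bases N) ->
  Y \in cocircuits N -> f \in supp Y ->
  restrict (ground N :\ f) Y \in cocircuits (delete f N).
Proof.
move=> bN /cocircuitP[sY mY mn oY] fY.
have eY : supp (restrict (ground N :\ f) Y) = supp Y :\ f.
  apply/setP=> x; rewrite !in_supp ffunE !in_setD1 in_supp.
  case: (x == f) => //=; case: ifP => // xN; case Yx: (Y x) => [c|//].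
  by move: (subsetP sY x); rewrite in_supp Yx xN => /(_ isT).
have fB B : B \in bases (delete f N) -> f \notin B.
  by move=> /basis_indep; rewrite independent_delete => /andP[].
apply/cocircuitP; rewrite eY; split.
- exact: setSD.
- move=> B bB; have /set0Pn[x] := mY B (bN B bB); rewrite in_setI => /andP[xB xY].
  apply/set0Pn; exists x; rewrite in_setI xB in_setD1 xY andbT.
  by apply: contraNneq (fB B bB) => <-.
- move=> K sK mK; have /subsetP sub : supp Y \subset f |: K.
    apply: mn => [|B bB].
      by rewrite subUset sub1set fY; apply: subset_trans sK (subsetDl _ _).
    have [fB'|fB'] := boolP (f \in B).
      by apply/set0Pn; exists f; rewrite in_setI fB' setU11.
    have bB' : B \in bases (delete f N).
      apply: basisI => [|S]; first by rewrite independent_delete fB' basis_indep.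
      by rewrite independent_delete => /andP[_ /(basis_max bB)]; apply.
    have /set0Pn[x] := mK B bB'; rewrite in_setI => /andP[xB xK].
    by apply/set0Pn; exists x; rewrite in_setI xB setU1r.
  by apply/subsetP=> x; rewrite in_setD1 => /andP[xf /sub]; rewrite in_setU1 (negPf xf).
move=> X; rewrite inE => /andP[CX fX].
have rE x : X x <> None -> restrict (ground N :\ f) Y x = Y x.
  move=> Xx; rewrite ffunE in_setD1; case: ifP => // /negbT; rewrite negb_and negbK.
  case/orP=> [/eqP xf|xN]; first by case/negP: fX; rewrite in_supp -xf; apply/eqP.
  by case Yx: (Y x) => [c|//]; case/negP: xN; apply: (subsetP sY); rewrite in_supp Yx.
apply: orthogonalI => x Xx; rewrite rE // => Yx.
have [[y [Yy XYy]] [z [Xz Yz XYz]]] := orthogonalE (oY X CX) Xx Yx.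
by split; [exists y | exists z]; rewrite rE // XYy.
Qed.

(** * Generic extensions and generic liftings *)

Lemma circuit_cocircuit_meet N X Y e : X \in circuits N -> Y \in cocircuits N ->
  e \in supp X -> e \in supp Y ->
  exists z, [/\ z \in supp X, z \in supp Y & z != e].
Proof.
move=> CX /cocircuitP[_ _ _ oY]; rewrite !in_supp => /eqP Xe /eqP Ye.
have [[y [Yy XYy]] [z [Xz Yz XYz]]] := orthogonalE (oY X CX) Xe Ye.
have [ze|ze] := eqVneq z e; last by exists z; rewrite !in_supp; split=> //; apply/eqP.
exists y; rewrite !in_supp XYy; split; [exact/eqP|exact/eqP|].
by apply: contra_notN XYz => /eqP ye; rewrite ze -ye.
Qed.

Lemma cocircuit_nonloop N Y e : Y \in cocircuits N -> e \in supp Y -> ~~ is_loop N e.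
Proof.
move=> CY eY; apply/is_loopP=> -[X CX eX].
have [|z []] := circuit_cocircuit_meet CX CY _ eY; first by rewrite eX set11.
by rewrite eX inE => ->.
Qed.

Lemma circuit_noncoloop N X e : X \in circuits N -> e \in supp X -> ~~ is_coloop N e.
Proof.
move=> CX eX; apply/imsetP=> -[Y CY eY].
have [|z []] := circuit_cocircuit_meet CX CY eX; first by rewrite -eY set11.
by rewrite -eY inE => _ ->.
Qed.

Lemma generic_extension_circuit N f B : generic_extension (delete f N) f N ->
  B \in bases (delete f N) -> f |: B \in circuit_supports N.
Proof.
move=> [_ _ _ e] bB; have : f |: B \in [set f |: B | B in bases (delete f N)].
  by apply: imset_f.
by rewrite -e inE => /andP[].
Qed.

Lemma generic_extension_circuitE N f X : generic_extension (delete f N) f N ->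
  X \in circuits N -> f \in supp X ->
  exists2 B, B \in bases (delete f N) & supp X = f |: B.
Proof.
move=> [_ _ _ e] CX fX; apply/imsetP; rewrite -e inE fX andbT; exact: imset_f.
Qed.

Lemma generic_lifting_cocircuitE N g Y : generic_lifting (contract g N) g N ->
  Y \in cocircuits N -> g \in supp Y ->
  exists2 B, B \in bases (contract g N) & supp Y = g |: (ground N :\ g :\: B).
Proof.
move=> [_ _ _ e] CY gY; apply/imsetP; rewrite -e inE gY andbT; exact: imset_f.
Qed.

Lemma generic_lifting_cocircuit N g B : generic_lifting (contract g N) g N ->
  B \in bases (contract g N) ->
  exists2 Y, Y \in cocircuits N & supp Y = g |: (ground N :\ g :\: B).
Proof.
move=> [_ _ _ e] bB.
have : g |: (ground N :\ g :\: B) \in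
    [set g |: (ground (contract g N) :\: B) | B in bases (contract g N)].
  by apply/imsetP; exists B.
by rewrite -e inE => /andP[/imsetP[Y CY eY] _]; exists Y.
Qed.

Lemma generic_lifting_nonloop N g : generic_lifting (contract g N) g N ->
  ~~ is_loop N g.
Proof.
move=> gl; have [_ [om _] _ _] := gl.
have [B bB] := exists_basis (contract_om g om).
have [Y CY eY] := generic_lifting_cocircuit gl bB.
by apply: cocircuit_nonloop CY _; rewrite eY setU11.
Qed.

(** Outside [g], a cocircuit through [g] disjoint from [D] is the complement of
    a basis of the contraction, and this basis contains [D], which is impossible because [D], having a
    nonempty trace, is dependent there.  The sign at [g] is thus free. *)
Lemma lifting_circuit N g (sg : T -> bool) D : generic_lifting (contract g N) g N ->
  D \in circuits N -> (forall x, D x <> Some (~~ sg x)) -> g \notin supp D ->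
  exists X, [/\ X \in circuits N, X g = Some (sg g),
     forall x, X x <> Some (~~ sg x) & supp X \subset g |: supp D].
Proof.
move=> gl CD sD gD; have [_ [om gN] _ _] := gl.
have gN' : g \in ground N by rewrite gN setU11.
have [||[X [CX Xg hX sX]]|[Y [CY Yg hY _]]] :=
    @painting N sg g (supp D) set0 om gN' (circuit_sub om CD) (sub0set _) gD.
- by rewrite inE.
- by rewrite -setI_eq0 setI0.
- rewrite setU0 in sX; exists X; split=> // x.
  have [->|xg] := eqVneq x g; first by rewrite Xg; case: (sg g).
  case Xx: (X x) => [c|//]; rewrite -Xx; apply: hX.
  by have := subsetP sX x; rewrite in_setU1 in_supp Xx (negPf xg); apply.
have gY : g \in supp Y by rewrite in_supp Yg.
have dXY : [disjoint supp D & supp Y].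
  have /cocircuitP[_ _ _ oY] := CY.
  exact: (conformal_disjoint (oY D CD) (fun x _ => sD x) hY).
have [B bB eY] := generic_lifting_cocircuitE gl CY gY.
have DB : supp D \subset B.
  apply/subsetP=> x xD; have := disjointFr dXY xD; rewrite eY !inE.
  rewrite (subsetP (circuit_sub om CD) x xD) andbT.
  by case: eqP => [xg|_] //=; rewrite andbT => /negbFE.
have Dg : supp D :\ g = supp D.
  by apply/setP=> x; rewrite in_setD1; case: eqP => // ->; rewrite (negPf gD).
have [/(_ D CD)[neD _] _ _ _] := om; rewrite -Dg in neD.
have [Z [CZ sZ _ tZ]] := contract_supp_lift om CD neD.
have /independentP[_ /(_ _ tZ)/negP[]] := basis_indep bB.
by rewrite supp_trace //; apply: subset_trans sZ _; rewrite Dg.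
Qed.

(** Dual to [lifting_circuit], but in the contraction by [g]: a circuit through
    [f] disjoint from [D] lifts to a circuit of [N] that consists of [f] and a
    basis, and [D], which is also a cocircuit of [N], would miss that basis. *)
Lemma extension_cocircuit N f g (sg : T -> bool) D :
  generic_extension (delete f N) f N -> g \in ground N -> f != g ->
  D \in cocircuits (contract g N) -> (forall x, D x <> Some (~~ sg x)) ->
  f \notin supp D ->
  exists Y, [/\ Y \in cocircuits (contract g N), Y f = Some (sg f) &
     forall x, Y x <> Some (~~ sg x)].
Proof.
move=> ge gN fg CD sD fD; have [_ [om fN] _ _] := ge.
have fN' : f \in ground N by rewrite fN setU11.
have [sDN _ _ oD] := cocircuitP _ _ CD.
pose R := ground (contract g N) :\: (f |: supp D).
have [||||[X [CX Xf hX _]]|[Y [CY Yf hY dY]]] :=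
    @painting (contract g N) sg f (supp D) R (contract_om g om) _ sDN _ fD.
- by rewrite ground_contract in_setD1 fg.
- exact: subsetDl.
- by rewrite !inE eqxx.
- rewrite disjoint_sym disjoints_subset; apply/subsetP=> x; rewrite !inE.
  by rewrite negb_or => /andP[/andP[]].
- have dXD := conformal_disjoint (oD X CX) hX (fun x _ => sD x).
  move: CX Xf dXD => /contractP-/(_ om)[X' [CX' -> _ _]]; rewrite traceE // (negPf fg).
  rewrite supp_trace // => Xf dXD.
  have [|B bB eX] := generic_extension_circuitE ge CX'; first by rewrite in_supp Xf.
  have bB' := basis_of_delete bB (generic_extension_circuit ge bB).
  have /cocircuitP[_ /(_ B bB')/set0Pn[x] + _ _] := cocircuit_of_contract om gN CD.
  rewrite in_setI => /andP[xB xD]; have := disjointFl dXD xD.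
  rewrite in_setD1 eX setU1r // andbT => /negbFE/eqP xg.
  by have := subsetP sDN x xD; rewrite xg !inE eqxx.
exists Y; split=> // x; have [->|xf] := eqVneq x f; first by rewrite Yf; case: (sg f).
case Yx: (Y x) => [c|//]; rewrite -Yx; apply: hY; apply: contraT => xD.
have xY : x \in supp Y by rewrite in_supp Yx.
have /cocircuitP[/subsetP/(_ x xY) xN _ _ _] := CY.
by have := disjointFr dY xY; rewrite in_setD xN in_setU1 (negPf xf) (negPf xD).
Qed.

End Matroids.


(** * Generic extension-liftings *)

Section ExtensionLiftings.
Variables (T : finType) (f g : T) (M N : circuit_system T).
Implicit Types (A B S : {set T}) (X Y : signed_set T).
Hypothesis fg : f != g.
Hypothesis el : generic_extension_lifting M f g N.
Lemma extlift_om : is_oriented_matroid N. Proof. by case: el => -[]. Qed.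
Lemma extlift_ground : ground N = f |: (g |: ground M). Proof. by case: el => -[]. Qed.
Lemma extlift_base : delete f (contract g N) = M. Proof. by case: el. Qed.
Lemma extlift_extension : generic_extension (delete f N) f N. Proof. by case: el. Qed.
Lemma extlift_lifting : generic_lifting (contract g N) g N. Proof. by case: el. Qed.
Lemma extlift_mem_f : f \in ground N. Proof. by rewrite extlift_ground setU11. Qed.
Lemma extlift_mem_g : g \in ground N. Proof. by rewrite extlift_ground setU1r // setU11. Qed.
Lemma extlift_ground_base : ground M = ground N :\ g :\ f. Proof. by rewrite -extlift_base. Qed.
#[local] Hint Resolve extlift_om extlift_mem_f extlift_mem_g : core.

Lemma mem_pair_reorientation A x : x \in ground M ->
  (x \in [set f; g] :|: A) = (x \in A).
Proof. by rewrite extlift_ground_base !inE => /and3P[/negPf-> /negPf->]. Qed.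

(** A circuit that becomes positive can be taken to pass through [g], by
    [lifting_circuit]; its trace is then a positive circuit of the reoriented
    [M], to which compatibility applies. *)
Lemma compatible_lifting_acyclic A : A \subset ground M ->
  compatible_lifting M g (delete f N) A =
  acyclic (delete f (reorient ([set f; g] :|: A) N)).
Proof.
move=> sA; set F := [set f; g] :|: A.
have gA : g \notin A by apply/negP=> /(subsetP sA); rewrite extlift_ground_base !inE eqxx andbF.
have gF : g \in F by rewrite !inE eqxx orbT.
apply/forall_inP/forall_inP => [comp X | acy C].
  rewrite inE mem_circuits_reorient => /andP[CX fX]; apply/negP=> pX.
  have hU x : resign F X x <> Some (~~ (x \notin F)).
    by rewrite negbK; move: x; apply/positive_resignP; rewrite resignK.
  have [V [CV Vg hV fV]] : exists V, [/\ V \in circuits N, V g = Some false,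
     forall x, V x <> Some (x \in F) & f \notin supp V].
    have [gU|gU] := boolP (g \in supp (resign F X)).
      exists (resign F X); split=> //; last by rewrite supp_resign.
        by move: gU (hU g); rewrite in_supp gF; case: (resign F X g) => [[]|].
      by move=> x; have := hU x; rewrite negbK.
    have [V [CV Vg hV sV]] :=
      @lifting_circuit _ _ _ (fun x => x \notin F) _ extlift_lifting CX hU gU.
    exists V; split=> //; first by rewrite Vg gF.
      by move=> x; have := hV x; rewrite negbK.
    apply/negP=> /(subsetP sV); rewrite in_setU1 (negPf fg) supp_resign /=.
    exact/negP.
  have gV : g \in supp V by rewrite in_supp Vg.
  have neV : supp V :\ g != set0.
    apply/negP=> /eqP V0; case/negP: (generic_lifting_nonloop extlift_lifting); apply/is_loopP.
    by exists V => //; rewrite -(setD1K gV) V0 setU0.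
  have tV := trace_contract extlift_om CV gV neV.
  have eV : restrict (ground M) V = restrict (ground N :\ g) V.
    by rewrite extlift_ground_base restrict_avoid.
  have CM : resign A (restrict (ground M) V) \in circuits (reorient A M).
    rewrite mem_circuits_reorient resignK eV -extlift_base inE tV /= supp_trace //.
    by rewrite in_setD1 (negPf fV) andbF.
  have pM : positive (resign A (restrict (ground M) V)).
    apply/positive_resignP=> x; rewrite ffunE; case: ifP => // xM.
    by rewrite -(mem_pair_reorientation _ xM).
  have /forall_inP/(_ (resign A V)) := implyP (comp _ CM) pM.
  rewrite mem_circuits_reorient resignK inE CV fV => /(_ isT)/implyP.
  rewrite supp_resign gV restrict_resign eqxx => /(_ isT).
  by rewrite inE ffunE (negPf gA) Vg.
move=> CC; apply/implyP=> pC; apply/forall_inP=> C'.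
rewrite mem_circuits_reorient inE => /andP[CC' fC']; apply/implyP=> /andP[gC' /eqP eC].
rewrite inE; apply/negPn/negP=> nC'.
set V := resign A C' in CC' fC'.
have /negP[] : ~~ positive (resign F V).
  by apply: acy; rewrite inE mem_circuits_reorient resignK CC' supp_resign.
apply/positive_resignP=> x Vx; have := subsetP (circuit_sub extlift_om CC') x.
rewrite in_supp Vx extlift_ground !in_setU1 => /(_ isT)/or3P[/eqP xf|/eqP xg|xM].
- by move: fC'; rewrite in_supp -xf Vx.
- by move: Vx nC'; rewrite xg gF ffunE (negPf gA) => ->.
have := positiveP pC (x := x); rewrite -eC ffunE xM => nx.
move: Vx nx; rewrite (mem_pair_reorientation _ xM) ffunE.
by case: (x \in A); case: (C' x) => [[]|].
Qed.

(** Adding [g] to [B] gives a basis of the deletion of [f] from [N], hence, by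
    genericity, a circuit through [f] and [g].  Its trace is a circuit formed by [f] and [B],
    so [B] is still maximal in the presence of [f]. *)
Lemma basis_contract_of_base B : B \in bases M -> B \in bases (contract g N).
Proof.
move=> bB; have ngl := generic_lifting_nonloop extlift_lifting.
have iE S : independent M S = [&& f \notin S, g \notin S & independent N (g |: S)].
  by rewrite -extlift_base independent_delete independent_contract // (negPf ngl).
have bgB : g |: B \in bases (delete f N).
  have := basis_indep bB; rewrite iE => /and3P[fB gB iB].
  apply: basisI => [|S].
    by rewrite independent_delete in_setU1 (negPf fg) fB.
  rewrite independent_delete => /andP[fS iS] sS.
  have gS : g \in S by apply: (subsetP sS); rewrite setU11.
  rewrite -(setD1K gS); congr (_ |: _); apply: (basis_max bB).
    by rewrite iE setD1K // !inE (negPf fS) eqxx andbF.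
  by rewrite subsetD1 gB andbT; apply: subset_trans (subsetUr _ _) sS.
have /imsetP[X CX eX] := generic_extension_circuit extlift_extension bgB.
apply: (@basis_of_delete _ f); first by rewrite extlift_base.
have gB : g \notin B by have := basis_indep bB; rewrite iE => /and3P[].
have eXg : supp X :\ g = f |: B.
  apply/setP=> x; rewrite -eX !inE; case: (eqVneq x g) => [->|_] //=.
  by rewrite (negPf gB) eq_sym (negPf fg).
rewrite -eXg -(supp_trace g extlift_om CX); apply: imset_f; apply: trace_contract => //.
  by rewrite -eX !inE eqxx orbT.
by rewrite eXg; apply/set0Pn; exists f; rewrite setU11.
Qed.

(** Dual to [compatible_lifting_acyclic]: a cocircuit that becomes positive can
    be taken to contain [f], and its restriction is a cocircuit of [M]. *)
Lemma compatible_extension_totally_cyclic A : A \subset ground M ->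
  compatible_extension M f (contract g N) A =
  totally_cyclic (contract g (reorient ([set f; g] :|: A) N)).
Proof.
move=> sA; set F := [set f; g] :|: A.
have fA : f \notin A by apply/negP=> /(subsetP sA); rewrite extlift_ground_base !inE eqxx.
have fF : f \in F by rewrite !inE eqxx.
rewrite contract_reorient.
apply/forall_inP/forall_inP => [comp Y | tc C].
  rewrite mem_cocircuits_reorient => CY; apply/negP=> pY.
  have hU x : resign F Y x <> Some (~~ (x \notin F)).
    by rewrite negbK; move: x; apply/positive_resignP; rewrite resignK.
  have [V [CV Vf hV]] : exists V, [/\ V \in cocircuits (contract g N),
      V f = Some false & forall x, V x <> Some (x \in F)].
    have [fU|fU] := boolP (f \in supp (resign F Y)).
      exists (resign F Y); split=> //.
        by move: fU (hU f); rewrite in_supp fF; case: (resign F Y f) => [[]|].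
      by move=> x; have := hU x; rewrite negbK.
    have [V [CV Vf hV]] := @extension_cocircuit _ _ _ _ (fun x => x \notin F) _
      extlift_extension extlift_mem_g fg CY hU fU.
    exists V; split=> //; first by rewrite Vf fF.
    by move=> x; have := hV x; rewrite negbK.
  have fV : f \in supp V by rewrite in_supp Vf.
  have CM : resign A (restrict (ground M) V) \in cocircuits (reorient A M).
    rewrite mem_cocircuits_reorient resignK extlift_ground_base -[X in cocircuits X]extlift_base.
    apply: cocircuit_delete => // B; rewrite extlift_base.
    exact: basis_contract_of_base.
  have pM : positive (resign A (restrict (ground M) V)).
    apply/positive_resignP=> x; rewrite ffunE; case: ifP => // xM.
    by rewrite -(mem_pair_reorientation _ xM).
  have /forall_inP/(_ (resign A V)) := implyP (comp _ CM) pM.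
  rewrite mem_cocircuits_reorient resignK CV => /(_ isT)/implyP.
  rewrite supp_resign fV restrict_resign eqxx => /(_ isT).
  by rewrite inE ffunE (negPf fA) Vf.
move=> CC; apply/implyP=> pC; apply/forall_inP=> C'.
rewrite mem_cocircuits_reorient => CC'; apply/implyP=> /andP[fC' /eqP eC].
rewrite inE; apply/negPn/negP=> nC'; set V := resign A C' in CC'.
have /negP[] : ~~ positive (resign F V).
  by apply: tc; rewrite mem_cocircuits_reorient resignK.
apply/positive_resignP=> x Vx.
have /cocircuitP[/subsetP/(_ x) + _ _ _] := CC'.
rewrite in_supp Vx => /(_ isT).
have [xf _|xf] := eqVneq x f.
  by move: Vx nC'; rewrite xf fF ffunE (negPf fA) => ->.
rewrite ground_contract => xN; have xM : x \in ground M by rewrite extlift_ground_base in_setD1 xf.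
have := positiveP pC (x := x); rewrite -eC ffunE xM => nx.
move: Vx nx; rewrite (mem_pair_reorientation _ xM) ffunE.
by case: (x \in A); case: (C' x) => [[]|].
Qed.

(** By genericity [g] is in a cocircuit and [f] in a circuit, and [g] is in the
    circuit of [f] or in its own fundamental circuit.  If [f] were a loop, the
    empty set would be a basis without [f], and [g] would be a loop. *)
Lemma extension_lifting_nondegenerate :
  [&& ~~ is_loop N f, ~~ is_coloop N f, ~~ is_loop N g & ~~ is_coloop N g].
Proof.
have ngl := generic_lifting_nonloop extlift_lifting; rewrite ngl.
have [B bB] := exists_basis_delete f extlift_om.
have /imsetP[X CX eX] := generic_extension_circuit extlift_extension bB.
have gd : g \in ground (delete f N) by rewrite in_setD1 eq_sym fg.
apply/and4P; split=> //.
- apply/is_loopP=> -[L CL eL].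
  have B0 : B = set0.
    have e : supp L = supp X.
      by apply: (circuit_supp_eq extlift_om CL CX); rewrite eL -eX sub1set setU11.
    apply/setP=> x; rewrite inE; apply/negP=> xB.
    have := basis_indep bB; rewrite independent_delete => /andP[/negP fB _]; apply: fB.
    by have /setP/(_ x) := eL; rewrite e -eX !inE xB orbT => /esym/eqP <-.
  have gB : g \notin B by rewrite B0 inE.
  have [Z [CZ gZ sZ]] := fundamental_circuit bB gd gB.
  case/negP: ngl; apply/is_loopP; exists Z; first by move: CZ; rewrite inE => /andP[].
  by apply/eqP; rewrite eqEsubset sub1set gZ andbT; rewrite B0 setU0 in sZ.
- by apply: circuit_noncoloop CX _; rewrite -eX setU11.
have [gB|gB] := boolP (g \in B).
  by apply: circuit_noncoloop CX _; rewrite -eX setU1r.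
have [Z [CZ gZ sZ]] := fundamental_circuit bB gd gB.
by apply: circuit_noncoloop gZ; move: CZ; rewrite inE => /andP[].
Qed.

(** Suppose that [e] is in just one of the two sets.  A circuit through [f] has
    the same sign at [f] in both reorientations, so it cannot contain [e].
    Since each basis without [f] gives such a circuit, [e] is a loop.  Then it
    is in no cocircuit, so by genericity of the lifting it is in a basis of the
    contraction, which a loop cannot be. *)
Lemma reorient_extlift_inj A A' : A \subset ground M -> A' \subset ground M ->
  reorient A N = reorient A' N -> A = A'.
Proof.
move=> sA sA' eN; apply/setP=> e; apply/eqP; apply: contraT => neq.
have eM : e \in ground M.
  case: (boolP (e \in A)) neq => [/(subsetP sA)//|_].
  by case: (boolP (e \in A')) => [/(subsetP sA')|].
have [eqf [eqg eNg]] : e != f /\ e != g /\ e \in ground N.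
  by move: eM; rewrite extlift_ground_base !inE => /and3P[].
have nf S : S \subset ground M -> f \notin S.
  by move=> sS; apply/negP=> /(subsetP sS); rewrite extlift_ground_base !inE eqxx.
have missX X : X \in circuits N -> f \in supp X -> e \notin supp X.
  move=> CX fX; have CX' : resign A' (resign A X) \in circuits N.
    by rewrite -mem_circuits_reorient -eN mem_circuits_reorient resignK.
  have [_ _ inc _] := extlift_om; have := inc _ _ CX' CX.
  rewrite !supp_resign => /(_ (subxx _)) h; apply/negP; rewrite in_supp => eX.
  case: h => /ffunP h.
    by move: (h e) eX neq; rewrite !ffunE; case: (e \in A); case: (e \in A'); case: (X e) => [[]|].
  move: (h f) fX; rewrite !ffunE in_supp (negPf (nf _ sA)) (negPf (nf _ sA')).
  by case: (X f) => [[]|].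
have missB B : B \in bases (delete f N) -> e \notin B.
  move=> bB; have /imsetP[X CX eX] := generic_extension_circuit extlift_extension bB.
  by apply: contra (missX X CX _) => [eB|]; rewrite -eX ?setU11 // setU1r.
have [L CL eL] : exists2 L, L \in circuits N & supp L = [set e].
  have [B bB] := exists_basis_delete f extlift_om.
  apply/is_loopP; apply: contraT => nl.
  have [|B' bB' /subsetP/(_ e)] := @extend_to_basis _ (delete f N) [set e].
    rewrite independent_delete inE eq_sym eqf; apply/independentP; rewrite sub1set.
    split=> // X CX; apply: contra nl; rewrite subset1 => /orP[/eqP eX|/eqP X0].
      by apply/is_loopP; exists X.
    by have [/(_ X CX)[]] := extlift_om; rewrite X0 eqxx.
  by rewrite set11 (negPf (missB _ bB')) => /(_ isT).
have [B bB] := exists_basis (contract_om g extlift_om).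
have [Y CY eY] := generic_lifting_cocircuit extlift_lifting bB.
have eB : e \in B.
  apply: contraT => eB; have eYe : e \in supp Y by rewrite eY !inE eB eqg eNg orbT.
  by case/negP: (cocircuit_nonloop CY eYe); apply/is_loopP; exists L.
(* The loop e is still dependent in the contraction. *)
have eLg : supp L :\ g = supp L.
  by apply/setP=> x; rewrite eL !inE; case: (eqVneq x e) => [->|]; rewrite ?andbF // eqg.
have [|Z [CZ sZ _ tZ]] := contract_supp_lift extlift_om CL (q := g).
  by rewrite eLg eL; apply/set0Pn; exists e; rewrite set11.
have /independentP[_ /(_ _ tZ)/negP[]] := basis_indep bB.
by rewrite supp_trace //; apply: subset_trans sZ _; rewrite eLg eL sub1set.
Qed.

Lemma pair_disjoint A : A \subset ground M -> [disjoint [set f; g] & A].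
Proof.
move=> sA; rewrite disjoint_sym disjoints_subset; apply/subsetP=> x /(subsetP sA).
by rewrite extlift_ground_base !inE negb_or => /and3P[-> ->].
Qed.

Lemma reorient_complement A : A \subset ground M ->
  reorient (ground M :\: A) N = reorient [set f; g] (reorient A N).
Proof.
move=> sA; rewrite reorient_reorient ?pair_disjoint //.
rewrite -[RHS]reorient_setC //.
  congr (reorient _ N); apply/setP=> x; rewrite extlift_ground_base !inE.
  by case: (x == f); case: (x == g); case: (x \in A).
rewrite !subUset !sub1set extlift_mem_f extlift_mem_g /=; apply: subset_trans sA _.
by rewrite extlift_ground_base; apply: subset_trans (subsetDl _ _) (subsetDl _ _).
Qed.

Lemma compatible_bounded A : A \subset ground M ->
  (A \in compatible_reorientations M f g N) =
  (ground M :\: A \in bounded_regions f g N).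
Proof.
move=> sA; have eN : reorient (ground M :\: A) N = reorient ([set f; g] :|: A) N.
  by rewrite reorient_complement // reorient_reorient // pair_disjoint.
rewrite !inE extension_lifting_nondegenerate sA eN -compatible_lifting_acyclic //.
rewrite -compatible_extension_totally_cyclic // !extlift_ground_base !inE !eqxx !andbF /=.
have -> : ground N :\ g :\ f :\: A \subset ground N.
  by rewrite !setDDl subsetDl.
exact: andbC.
Qed.

End ExtensionLiftings.

Theorem proposition4 (T : finType) (E : {set T}) (f g : T)
    (M Mbar : circuit_system T)
    (fE : f \notin E) (gE : g \notin E) (fg : f <> g)
    (omM : oriented_matroid_on E M)
    (elM : generic_extension_lifting M f g Mbar) :
  [/\ {in compatible_reorientations M f g Mbar &,
        injective (fun A : {set T} => reorient [set f; g] (reorient A Mbar))},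
      [set reorient [set f; g] (reorient A Mbar)
         | A in compatible_reorientations M f g Mbar] =
      [set reorient B Mbar | B in bounded_regions f g Mbar]
    & {in bounded_regions f g Mbar &,
        injective (fun B : {set T} => reorient B Mbar)}].
Proof.
have gM : ground M = E by case: omM.
have sub B : B \in bounded_regions f g Mbar -> B \subset E.
  rewrite inE => /andP[_ /and5P[sB fB gB _ _]]; have [[_ gN] _ _ _] := elM.
  apply/subsetP=> x xB; have := subsetP sB x xB; rewrite gN gM !in_setU1.
  by case/or3P=> // /eqP xe; [move: fB|move: gB]; rewrite -xe xB.
have subc A : A \in compatible_reorientations M f g Mbar -> A \subset E.
  by rewrite inE gM => /and3P[].
have fg' : f != g by apply/eqP.
split.
- move=> A A' /subc sA /subc sA' eAA'.
  apply: (reorient_extlift_inj elM); rewrite ?gM //.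
  exact: (can_inj (reorientK [set f; g])) eAA'.
- apply/setP=> N; apply/imsetP/imsetP => [[A cA ->]|[B bB ->]].
    have sA := subc A cA; exists (E :\: A).
      by rewrite -gM -(compatible_bounded fg' elM) // gM.
    by rewrite -gM (reorient_complement elM) // gM.
  have sB := sub B bB; have EB : E :\: (E :\: B) = B.
    by rewrite setDDr setDv set0U; apply/setIidPr.
  exists (E :\: B); first by rewrite (compatible_bounded fg' elM) gM ?subsetDl // EB.
  by rewrite -(reorient_complement elM) gM ?subsetDl // EB.
move=> B B' /sub sB /sub sB' eBB'.
by apply: (reorient_extlift_inj elM); rewrite ?gM.
Qed.
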